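(* Let $\lambda\ge0$, $\sqrt Q=e^\lambda+e^{-\lambda}$, $L$ even and $\beta>0$. For every function $f:\{-1,1\}^{\Lambda_L}\to\mathbb R$ (viewed as the operator $f(\tau^z)$ diagonal in the $\tau^z$-basis), $$\langle f(\tau^z)\rangle^{(\mathrm{XXZ},+)}_{L,\beta,\lambda}=\int\mathbb E_+(f\mid\omega)\,\mu_{L,\beta}(d\omega),\qquad \langle f(\tau^z)\rangle^{(\mathrm{XXZ},-)}_{L,\beta,-\lambda}=\int\mathbb E_-(f\mid\omega)\,\mu_{L,\beta}(d\omega),$$ where $$\mathbb E_\pm(f\mid\omega)=\frac1{\sqrt Q^{\,N_\ell(\omega)}}\sum_\tau\mathbb 1[\omega,\tau]\,W_\pm(\omega,\tau)\,f(\tau(\cdot,0)),\qquad W_\pm(\omega,\tau)=\prod_{\ell\ \text{ccw}}e^{\pm\lambda}\prod_{\ell\ \text{cw}}e^{\mp\lambda},$$ the products running over counterclockwise, resp. clockwise, oriented loops $\ell$ of $(\omega,\tau)$.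
   Context: XXZ setup: Pauli matrices $\tau^\alpha$ on $\mathbb C^2$, $\tau^z|\pm\rangle=\pm|\pm\rangle$, $\Lambda_L=\{-L+1,\dots,L\}$, $\mathcal H_L=\bigotimes_{v\in\Lambda_L}\mathbb C^2$. $H^{(L)}_{\mathrm{XXZ}}=-\tfrac12\sum_{v=-L+1}^{L-1}[\tau^x_v\tau^x_{v+1}+\tau^y_v\tau^y_{v+1}-\cosh\lambda(\tau^z_v\tau^z_{v+1}-1)]$, $H^{(L,\pm)}_{\mathrm{XXZ}}=H^{(L)}_{\mathrm{XXZ}}\pm\sinh(\lambda)(-1)^L(\tau^z_{-L+1}-\tau^z_L)/2$. Seed $|N^{(L)}_\lambda\rangle=\bigotimes_{j=1}^L(e^{-\lambda/2}|+,-\rangle+e^{\lambda/2}|-,+\rangle)_{-L+2j-1,-L+2j}$, and $$\langle F\rangle^{(\mathrm{XXZ},\pm)}_{L,\beta,\lambda'}=\frac{\langle N^{(L)}_{\lambda'}|e^{-\beta H^{(L,\pm)}_{\mathrm{XXZ}}/2}Fe^{-\beta H^{(L,\pm)}_{\mathrm{XXZ}}/2}|N^{(L)}_{\lambda'}\rangle}{\langle N^{(L)}_{\lambda'}|e^{-\beta H^{(L,\pm)}_{\mathrm{XXZ}}}|N^{(L)}_{\lambda'}\rangle}.$$ Loop model: $\Lambda_{L,\beta}=\Lambda_L\times[-\beta/2,\beta/2]$. A rung configuration $\omega$ is a finite set of pairs $(b,t)$ with $b=\{u,u+1\}$, $-L+1\le u\le L-1$, $t\in(-\beta/2,\beta/2)$;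 $\rho_{\Lambda_{L,\beta}}$ is the law of independent Poisson point processes of intensity $dt$ on each of these $2L-1$ columns. Loops of $\omega$: draw the vertical segments $\{u\}\times[-\beta/2,\beta/2]$; replace each rung at edge $\{u,u+1\}$, time $t$, by two infinitesimally separated horizontal segments joining $u$ and $u+1$ just below and just above $t$, removing the piece of columns $u,u+1$ between them (so paths make U-turns at rungs); at $t=\beta/2$ and at $t=-\beta/2$ join the endpoints of columns $-L+2j-1$ and $-L+2j$ for $j=1,\dots,L$ (capping). The resulting set is a disjoint union of closed loops; $N_\ell(\omega)$ is their number. $\mu_{L,\beta}(d\omega)=\sqrt Q^{\,N_\ell(\omega)}\rho_{\Lambda_{L,\beta}}(d\omega)/\mathrm{Norm}$. A pseudo-spin configuration $\tau:\Lambda_{L,\beta}\to\{-1,1\}$ is constant in $t$ on each column except at rung times; $\mathbb 1[\omega,\tau]=1$ iff $\tau$ defines a consistent orientation of every loop (traversing vertical pieces upward where $\tau=+1$, downward where $\tau=-1$; equivalently $\tau$ is constant along vertical pieces and reverses at each U-turn). Each loop is then counterclockwise (ccw) or clockwise (cw). *)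

(* Defs.v *)
From HB Require Import structures.
From mathcomp Require Import all_boot all_order all_algebra.
From mathcomp Require Import all_classical all_reals all_analysis.
Set Implicit Arguments. Unset Strict Implicit. Unset Printing Implicit Defensive.
Import Order.TTheory GRing.Theory Num.Theory.
Import numFieldNormedType.Exports.
Local Open Scope ring_scope.

(* Lattice Lambda_L = {-L+1,...,L}; the physical site -L+1+i is        *)
(* represented by the ordinal i : 'I_(2L).  Bonds {u,u+1},             *)
(* -L+1 <= u <= L-1, are represented by b : 'I_(2L-1) (joining sites  *)
(* b and b+1).                                                          *)
Definition site (L : nat) := 'I_(L.*2).
Definition bond (L : nat) := 'I_(L.*2.-1).

Lemma bond_lt (n : nat) (b : 'I_n.-1) : (b.+1 < n)%N.
Proof. by case: n b => [[]|n] b //=; rewrite ltnS ltn_ord. Qed.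

Definition bl L (b : bond L) : site L := widen_ord (leq_pred _) b.
Definition br L (b : bond L) : site L := Ordinal (bond_lt b).

(* capping partner: sites 2j-2 and 2j-1 (0-indexed), i.e. physical
   -L+2j-1 and -L+2j *)
Definition partner L (v : site L) : site L :=
  insubd v (if odd v then (nat_of_ord v).-1 else (nat_of_ord v).+1).

(* tau^z basis: a configuration; true = |+>, false = |-> *)
Definition conf L := {ffun site L -> bool}.
Definition spin {R : pzRingType} (b : bool) : R := if b then 1 else -1.
Definition flip L (v : site L) (s : conf L) : conf L :=
  [ffun w => if w == v then ~~ s w else s w].

(* Operators on H_L, as real matrices A s s' = <s|A|s'> in the tau^z  *)
(* basis (every operator occurring here has real matrix elements).     *)
Definition op (R : realType) L := conf L -> conf L -> R.

Section Ops.
Variables (R : realType) (L : nat).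
Implicit Types (A B : op R L).

Definition op_id : op R L := fun s s' => (s == s')%:R.
Definition op_add A B : op R L := fun s s' => A s s' + B s s'.
Definition op_scale (c : R) A : op R L := fun s s' => c * A s s'.
Definition op_mul A B : op R L := fun s s'' => \sum_(s' : conf L) A s s' * B s' s''.
Definition op_pow A (k : nat) : op R L := iter k (op_mul A) op_id.
Definition op_exp (c : R) A : op R L :=
  fun s s' => limn (fun N => \sum_(k < N) c ^+ k / (k`!)%:R * op_pow A k s s').
Definition op_diag (f : conf L -> R) : op R L := fun s s' => (s == s')%:R * f s.

(* Pauli operators.  tau^x|s> = |-s>, tau^y|s> = i s|-s>, tau^z|s> = s|s>.
   Hence tau^y_v tau^y_w (v <> w) maps |s> to (i s_v)(i s_w) = -s_v s_w
   times the configuration with both spins flipped: it is real.       *)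
Definition tz (v : site L) : op R L := fun s s' => (s == s')%:R * spin (s' v).
Definition txtx (v w : site L) : op R L := fun s s' => (s == flip v (flip w s'))%:R.
Definition tyty (v w : site L) : op R L :=
  fun s s' => (s == flip v (flip w s'))%:R * - (spin (s' v) * spin (s' w)).
Definition tztz (v w : site L) : op R L := fun s s' => (s == s')%:R * (spin (s' v) * spin (s' w)).
Definition tz_at (n : nat) : op R L := fun s s' => \sum_(v : site L | nat_of_ord v == n) tz v s s'.

Definition coshR (x : R) := (expR x + expR (- x)) / 2.
Definition sinhR (x : R) := (expR x - expR (- x)) / 2.

Definition H_XXZ (lam : R) : op R L := fun s s' =>
  - (1/2) * \sum_(b : bond L)
     (txtx (bl b) (br b) s s' + tyty (bl b) (br b) s s'
      - coshR lam * (tztz (bl b) (br b) s s' - op_id s s')).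

Definition H_XXZ_pm (pl : bool) (lam : R) : op R L := fun s s' =>
  H_XXZ lam s s' + spin pl * sinhR lam * (-1) ^+ L *
     (tz_at 0 s s' - tz_at (L.*2.-1) s s') / 2.

Definition pair_coef (lam' : R) (a b : bool) : R :=
  if a && ~~ b then expR (- lam' / 2)
  else if ~~ a && b then expR (lam' / 2) else 0.
Definition seed (lam' : R) (s : conf L) : R :=
  \prod_(v : site L | ~~ odd v) pair_coef lam' (s v) (s (partner v)).

Definition braket (lam' : R) A : R :=
  \sum_(s : conf L) \sum_(s' : conf L) seed lam' s * A s s' * seed lam' s'.

Definition xxz_avg (pl : bool) (lam lam' beta : R) (f : conf L -> R) : R :=
  let E := op_exp (- (beta / 2)) (H_XXZ_pm pl lam) in
  braket lam' (op_mul E (op_mul (op_diag f) E)) /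
  braket lam' (op_exp (- beta) (H_XXZ_pm pl lam)).

End Ops.

(* A rung configuration is a finite list of rungs (b, t), b a bond,    *)
(* t a time.  Sorting by time t_1 <= ... <= t_n (ties have measure 0), *)
(* the column of site v is cut into "atoms" (v,k), k = 0..n, the piece *)
(* of column v in the time slab (t_k, t_{k+1}) (t_0 = -beta/2,         *)
(* t_{n+1} = beta/2).  Each atom has a bottom end and a top end; the   *)
(* loop picture glues ends as follows (function nbr):                  *)
(*  - top end of (v,n): capped to top end of (partner v, n);           *)
(*  - top end of (v,k), k<n, rung k+1 on bond {u,u+1}: if v = u or     *)
(*    u+1, U-turn to top end of the other site's atom (.,k); otherwise *)
(*    straight to the bottom end of (v,k+1);                            *)
(*  - symmetric rules for bottom ends.                                  *)
(* es is the list of (0-based) bond positions u of the sorted rungs.   *)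
Section Loops.
Variables (L : nat) (es : seq nat).
Let n := size es.
Definition atom := (site L * 'I_n.+1)%type.

Definition nbr (a : atom) (top : bool) : atom * bool :=
  let v := nat_of_ord a.1 in let k := nat_of_ord a.2 in
  if top then
    if k == n then ((partner a.1, a.2), true)
    else let u := nth 0%N es k in
      if v == u then ((insubd a.1 u.+1, a.2), true)
      else if v == u.+1 then ((insubd a.1 u, a.2), true)
      else ((a.1, insubd a.2 k.+1), false)
  else
    if k == 0%N then ((partner a.1, a.2), false)
    else let u := nth 0%N es k.-1 in
      if v == u then ((insubd a.1 u.+1, a.2), false)
      else if v == u.+1 then ((insubd a.1 u, a.2), false)
      else ((a.1, insubd a.2 k.-1), true).

Definition adj : rel atom := fun a b => [exists e : bool, (nbr a e).1 == b].

Definition loops : {set {set atom}} := [set [set b | connect adj a b] | a : atom].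
Definition nloops : nat := #|loops|.

(* pseudo-spin configuration: value on each atom, true = +1 (upward) *)
Definition pspin := {ffun atom -> bool}.

(* 1[omega, tau]: constant along straight gluings, reversed at U-turns *)
Definition consistent (tau : pspin) : bool :=
  [forall a : atom, forall e : bool,
     let: (b, e') := nbr a e in
     if e == e' then tau b != tau a else tau b == tau a].

(* signed turning (in quarter turns, left = +) when leaving atom a in
   the direction prescribed by tau: a U-turn from column v to column w
   contributes two turns, 2 * spin(tau a) * (v - w). *)
Definition turn (R : realType) (tau : pspin) (a : atom) : R :=
  let: (b, e') := nbr a (tau a) in
  if e' == tau a then 2 * spin (tau a) * ((nat_of_ord a.1)%:R - (nat_of_ord b.1)%:R)
  else 0.
Definition turning (R : realType) (tau : pspin) (l : {set atom}) : R :=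
  \sum_(a in l) turn R tau a.
(* counterclockwise = total turning +2pi, clockwise = total turning -2pi *)
Definition ccw (R : realType) tau l : bool := 0 < turning R tau l.
Definition cw (R : realType) tau l : bool := turning R tau l < 0.

(* tau(., 0) when time 0 lies in slab k0 *)
Definition tau_at (tau : pspin) (k0 : nat) : conf L := [ffun v => tau (v, inord k0)].

Definition W (R : realType) (pl : bool) (lam : R) (tau : pspin) : R :=
  \prod_(l in loops | ccw R tau l) expR (spin pl * lam) *
  \prod_(l in loops | cw R tau l) expR (- (spin pl * lam)).

End Loops.

Definition rung (R : realType) L := (bond L * R)%type.
Definition rconf (R : realType) L := seq (rung R L).

Section LoopModel.
Variables (R : realType) (L : nat).

Definition sort_rungs (w : rconf R L) : rconf R L :=
  sort (fun r1 r2 : rung R L => r1.2 <= r2.2) w.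
Definition bond_list (w : rconf R L) : seq nat :=
  [seq nat_of_ord r.1 | r <- sort_rungs w].
Definition N_loops (w : rconf R L) : nat := nloops L (bond_list w).
(* index of the time slab containing t = 0 *)
Definition slab0 (w : rconf R L) : nat := count (fun r : rung R L => r.2 < 0) w.

Definition sqrtQ (lam : R) : R := expR lam + expR (- lam).

Definition Econd (pl : bool) (lam : R) (f : conf L -> R) (w : rconf R L) : R :=
  (sqrtQ lam ^+ N_loops w)^-1 *
  \sum_(tau : pspin L (bond_list w))
     (consistent tau)%:R * W pl lam tau * f (tau_at tau (slab0 w)).

Fixpoint iint (beta : R) (n : nat) (G : seq R -> R) : R :=
  match n with
  | 0 => G [::]
  | n'.+1 => Rintegral (@lebesgue_measure R) `](- (beta / 2)), (beta / 2)[%classic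
               (fun x => iint beta n' (fun ts => G (x :: ts)))
  end.

(* integral w.r.t. rho_{Lambda_{L,beta}}: independent Poisson point
   processes of intensity dt on the 2L-1 columns, i.e. a Poisson process
   of intensity (counting on bonds) x dt on bonds x (-beta/2,beta/2):
   E[F] = e^{-(2L-1) beta} sum_n 1/n! sum_{b_1..b_n} int F((b_i,t_i)_i) dt *)
Definition rho_int (beta : R) (F : rconf R L -> R) : R :=
  limn (fun M => \sum_(n < M)
     expR (- ((L.*2.-1)%:R * beta)) / (n`!)%:R *
     \sum_(bs : n.-tuple (bond L)) iint beta n (fun ts => F (zip bs ts))).

Definition mu_int (lam beta : R) (G : rconf R L -> R) : R :=
  rho_int beta (fun w => sqrtQ lam ^+ N_loops w * G w) /
  rho_int beta (fun w => sqrtQ lam ^+ N_loops w).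

End LoopModel.

(* Main.v *)
(** The boundary term telescopes over the bonds, so that for even [L] the operator
    [- H_XXZ_pm true lam] is a sum over bonds of rank-one operators xi xi^T with xi = e^(-lam/2) |+-> + e^(lam/2) |-+>, and the seed is a product of
    the same vectors xi. Expanding the exponentials in words of bonds therefore gives sums over
    the configurations on the time slabs of a product of factors e^(+-lam/2), one for each U-turn,
    with sign given by the sense of the turn. That this product is the weight e^(+-lam) of the
    orientation of every loop is a Hopf Umlaufsatz. It follows by growing the diagram upwards: the
    arcs below a horizontal line form a noncrossing matching, and every arc has total turning +-2
    according to whether it is traversed from left to right or from right to left. Closing an arc
    by a last U-turn then gives total turning +-4.

    On the Poisson side, the integrand depends on the times only through their order and the
    number of negative ones. Summing over all words of bonds removes the order, and the number of
    negative times is binomial, which is the Cauchy product of the two exponential series. The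
    case of the minus sign is the case of the plus sign with [lam] replaced by [- lam]. *)
Require Import Defs.
From HB Require Import structures.
From mathcomp Require Import all_boot all_order all_algebra.
From mathcomp Require Import all_classical all_reals all_analysis.
From mathcomp Require Import measurable_realfun.
From mathcomp Require Import zify ring lra.
Set Implicit Arguments. Unset Strict Implicit. Unset Printing Implicit Defensive.
Import Order.TTheory GRing.Theory Num.Theory.
Import numFieldNormedType.Exports.
Local Open Scope ring_scope.

(** * Turning of loops *)

Section Reach.
Variables (T : finType) (V : zmodType) (f : T -> T) (w : T -> V).
Implicit Types (D : pred T) (x y z : T) (s : V).

(** A nonempty path for [f]. The weight of [x] counts and that of [y] does not, so weights add under
    concatenation; [D] constrains only the points strictly between. *)
Definition reach D x y s := exists m, [/\ iter m.+1 f x = y,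
  \sum_(i < m.+1) w (iter i f x) = s
  & forall i, (0 < i <= m)%N -> D (iter i f x)].

Lemma reach_step D x : reach D x (f x) (w x).
Proof.
exists 0%N; split => //; first by rewrite big_ord_recl big_ord0 addr0.
by case.
Qed.

Lemma reach_trans D x y z s t :
  reach D x y s -> D y -> reach D y z t -> reach D x z (s + t).
Proof.
move=> [m [my ms mD]] Dy [p [pz pt pD]].
have itE i : iter (m.+1 + i) f x = iter i f y by rewrite addnC iterD my.
exists (m + p.+1)%N; split.
- by rewrite -addSn itE pz.
- rewrite -addSn big_split_ord /= -ms -pt; congr (_ + _).
  by apply: eq_bigr => i _; rewrite -itE.
- move=> i /andP[i0 im]; case: (ltngtP i m.+1) => [im1|im1|->].
  + by apply: mD; rewrite i0.
  + have -> : i = (m.+1 + (i - m.+1))%N by lia.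
    by rewrite itE; apply: pD; lia.
  + by rewrite my.
Qed.

Lemma reachW D D' x y s : (forall a, D a -> D' a) -> reach D x y s -> reach D' x y s.
Proof. by move=> DD' [m [? ? mD]]; exists m; split=> // i /mD/DD'. Qed.

(** The intermediate points satisfy [D], hence differ from [x]: the path meets [x] again only at its
    end and runs through the orbit exactly once. *)
Lemma reach_loop D x s : injective f -> reach D x x s -> ~~ D x ->
  \sum_(a | fconnect f x a) w a = s.
Proof.
move=> fI [m [mx <- mD]] Dx.
have om : order f x = m.+1.
  apply/eqP; rewrite eqn_leq; apply/andP; split; last first.
    rewrite ltnNge; apply: contra Dx => om.
    by rewrite -[X in D X](iter_order fI); apply: mD; rewrite order_gt0.
  rewrite leqNgt; apply/negP => mo.
  have := orbit_uniq f x; rewrite /orbit => /uniqP/(_ 0%N m.+1).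
  rewrite !inE size_traject order_gt0 => /(_ x erefl mo).
  by rewrite !nth_traject ?order_gt0 // mx => /(_ erefl).
rewrite (eq_bigl (mem (orbit f x))); last by move=> a; rewrite /= fconnect_orbit.
rewrite -big_uniq ?orbit_uniq //= /orbit om (big_nth x) size_traject big_mkord.
by apply: eq_bigr => i _; rewrite nth_traject.
Qed.

End Reach.

(** * Noncrossing matchings and the closing of two neighbouring columns *)

Section Matching.
Local Open Scope nat_scope.

(** The parity clause fixes the direction of every arc: in the reference orientation below, its odd
    end goes down and its even end comes up. *)
Definition matching (F : pred nat) (p : nat -> nat) :=
  [/\ forall v, F v -> F (p v), forall v, F v -> p (p v) = v,
      forall v, F v -> odd (p v) = ~~ odd v
    & forall v w, F v -> F w -> ~~ [&& v < w, w < p v & p v < p w]].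

(** Effect on the other columns of closing [u] and [u.+1] from above: their former partners become
    partners of each other. *)
Definition join (u : nat) (p : nat -> nat) v :=
  if p v == u then p u.+1 else if p v == u.+1 then p u else p v.

(** No column lies between [u] and [u.+1], so an arc ending at neither has both on the same side. If
    it crosses the new arc, it crosses one of the two old arcs that ended there. *)
Lemma matching_join F p u : matching F p -> F u -> F u.+1 ->
  matching (fun v => [&& F v, v != u & v != u.+1]) (join u p).
Proof.
move=> [pF pK po nc] Fu Fu1.
have key v : F v -> v != u -> v != u.+1 ->
  [\/ p v = u /\ join u p v = p u.+1, p v = u.+1 /\ join u p v = p u
    | [/\ p v <> u, p v <> u.+1 & join u p v = p v]].
  move=> Fv _ _; rewrite /join; case: eqP => [->|?]; first by constructor 1.
  by case: eqP => [->|?]; [constructor 2|constructor 3].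
have pu := pK _ Fu; have pu1 := pK _ Fu1.
have ou := po _ Fu; have ou1 := po _ Fu1.
split=> [v|v|v|v w] /and3P[Fv vu vu1].
- have pv := pK _ Fv; have pFv := pF _ Fv.
  have [[e ->]|[e ->]|[e1 e2 ->]] := key _ Fv vu vu1.
  + rewrite pF //=; apply/andP; split; apply/eqP => e'; last first.
      by have := po _ Fu1; rewrite e' => /esym; case: (odd _).
    by move/eqP: vu1; apply; rewrite -[LHS]pv e -[RHS]pu1 e'.
  + rewrite pF //=; apply/andP; split; apply/eqP => e'.
      by move: ou; rewrite e'; case: (odd u).
    by move/eqP: vu; apply; rewrite -[LHS]pv e -[RHS]pu e'.
  + by rewrite pFv /=; apply/andP; split; apply/eqP.
- have pv := pK _ Fv; have pFv := pF _ Fv.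
  have [[e je]|[e je]|[e1 e2 je]] := key _ Fv vu vu1.
  + by rewrite je /join pu1 eqxx (_ : (u.+1 == u) = false) -?e ?pv //; lia.
  + by rewrite je /join pu eqxx -e pv.
  + by rewrite je /join pv (negbTE vu) (negbTE vu1).
- have ov := po _ Fv.
  by have [[e ->]|[e ->]|[e1 e2 ->]] := key _ Fv vu vu1 => //; lia.
- move=> /and3P[Fw wu wu1].
  have pv := pK _ Fv; have pw := pK _ Fw.
  clear po ou ou1; have Fpv := pF _ Fv; have Fpw := pF _ Fw.
  have Fpu := pF _ Fu; have Fpu1 := pF _ Fu1.
  have := nc _ _ Fv Fw.
  have [[e ->]|[e ->]|[e1 e2 ->]] := key _ Fv vu vu1;
  have [[e' ->]|[e' ->]|[e1' e2' ->]] := key _ Fw wu wu1 => //.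
  + by move: pv pw; rewrite e e'; lia.
  + by move: pw; rewrite e'; lia.
  + have := nc _ _ Fu1 Fw; have := nc _ _ Fw Fpu1; rewrite pu1 e; lia.
  + by move: pw; rewrite e'; lia.
  + by move: pv pw; rewrite e e'; lia.
  + have := nc _ _ Fu Fw; have := nc _ _ Fw Fpu; rewrite pu e; lia.
  + have := nc _ _ Fv Fu1; have := nc _ _ Fpw Fv; rewrite pw e'; lia.
  + have := nc _ _ Fv Fu; have := nc _ _ Fpw Fv; rewrite pw e'; lia.
Qed.

(** Turning, in quarter turns, of an arc below the line: from left to right it turns
    counterclockwise. *)
Definition arc_turn (a b : nat) : int := if a < b then 2%R else (- 2)%R.

(* The arcs from v to u and from u + 1 to p (u + 1), joined by the U-turn of
   turning -2 from u to u + 1, or the same with u and u + 1 exchanged. Without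
   planarity the identity fails, e.g. when p (u + 1) < u < u + 1 < v. *)
Lemma matching_join_sgn F p u v (c := arc_turn) :
  matching F p -> F u -> F u.+1 -> F v -> v != u -> v != u.+1 ->
  ((p v = u -> c v u - 2 + c u.+1 (p u.+1) = c v (p u.+1)) /\
  (p v = u.+1 -> c v u.+1 + 2 + c u (p u) = c v (p u)))%R.
Proof.
move=> [pF pK po nc] Fu Fu1 Fv vu vu1.
have pu := pK _ Fu; have pu1 := pK _ Fu1; have pv := pK _ Fv.
have Fpu := pF _ Fu; have Fpu1 := pF _ Fu1.
have npu : p u != u by apply/eqP => e; have := po _ Fu; rewrite e; case: (odd u).
have npu1 : p u.+1 != u.+1.
  by apply/eqP => e; have := po _ Fu1; rewrite e; case: (odd u.+1).
clear po; split => e.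
- have := nc _ _ Fpu1 Fu; have := nc _ _ Fu1 Fv; have := nc _ _ Fv Fpu1.
  have := nc _ _ Fu Fu1; have := nc _ _ Fv Fu1.
  have pue : p u = v by rewrite -e pv.
  rewrite pue pu1 e /c /arc_turn.
  have zu : p u.+1 != u by apply: contra_neq vu1 => h; rewrite -pue -[X in p X]h pu1.
  by move=> *; do 3 case: ltnP => ?; lia.
- have := nc _ _ Fpu1 Fu; have := nc _ _ Fv Fu; have := nc _ _ Fu Fpu1.
  have := nc _ _ Fpu Fv; have := nc _ _ Fu Fu1.
  have pue : p u.+1 = v by rewrite -e pv.
  rewrite pue pu e /c /arc_turn.
  have zu : p u != u.+1 by apply: contra_neq vu => h; rewrite -pue -[X in p X]h pu.
  have zv : p u != v by apply/eqP => h; move: pu; rewrite h e; lia.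
  by move=> *; do 3 case: ltnP => ?; lia.
Qed.

End Matching.

Section Partner.

Definition mate (v : nat) := if odd v then v.-1 else v.+1.

Lemma partner_val L (v : site L) : partner v = mate v :> nat.
Proof.
rewrite /partner val_insubd /mate; have vL := ltn_ord v.
by case: ifP => // /negP []; case: ifP => ?; lia.
Qed.

Lemma mateK : involutive mate.
Proof.
move=> v; rewrite /mate; have [ov|ev] := boolP (odd v); last by rewrite /= ev.
by case: v ov => //= v /negbTE ->.
Qed.

Lemma partnerK L : involutive (@partner L).
Proof. by move=> v; apply: val_inj; rewrite /= !partner_val mateK. Qed.

End Partner.

(** * The gluing of atom ends as an involution, and loops as orbits *)

Section Gluing.
Variables (L : nat) (es : seq nat).
Hypothesis es_lt : all (fun u => u.+1 < L.*2)%N es.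
Local Notation n := (size es).
Implicit Types (a b : atom L es) (tau : pspin L es).

Lemma nth_es_lt k : (k < n)%N -> ((nth 0 es k).+1 < L.*2)%N.
Proof. by move=> kn; move/all_nthP: es_lt => /(_ 0%N k kn). Qed.

Lemma atomP a b : a.1 = b.1 :> nat -> a.2 = b.2 :> nat -> a = b.
Proof. by case: a b => [v k] [w l] /= /val_inj -> /val_inj ->. Qed.

(** The four kinds of gluing, with columns and slabs compared as natural numbers. The bound [es_lt]
    rules out the default values of [insubd] at rungs. *)
Variant nbr_spec a : bool -> atom L es * bool -> Type :=
| NbrCap e b of a.2 = (if e then n else 0%N) :> nat
    & b.1 = mate a.1 :> nat & b.2 = a.2 :> nat : nbr_spec a e (b, e)
| NbrTurn e b u of (if e then a.2 < n else 0 < a.2)%N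
    & u = nth 0%N es (if e then a.2 : nat else a.2.-1)
    & (a.1 = u :> nat /\ b.1 = u.+1 :> nat) \/ (a.1 = u.+1 :> nat /\ b.1 = u :> nat)
    & b.2 = a.2 :> nat : nbr_spec a e (b, e)
| NbrUp b u of (a.2 < n)%N & u = nth 0%N es a.2 & a.1 <> u :> nat
    & a.1 <> u.+1 :> nat & b.1 = a.1 :> nat & b.2 = a.2.+1 :> nat
    : nbr_spec a true (b, false)
| NbrDown b u of (0 < a.2)%N & u = nth 0%N es a.2.-1 & a.1 <> u :> nat
    & a.1 <> u.+1 :> nat & b.1 = a.1 :> nat & b.2 = a.2.-1 :> nat
    : nbr_spec a false (b, true).

Lemma nbrP a e : nbr_spec a e (nbr a e).
Proof.
have := ltn_ord a.2; have := ltn_ord a.1; rewrite /nbr ltnS => a1 a2.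
case: e; case: eqP => ak.
- by apply: NbrCap => //; rewrite partner_val.
- have kn : (a.2 < n)%N by lia.
  have uL := nth_es_lt kn.
  case: eqP => au; [|case: eqP => au1].
  + by apply: NbrTurn => //=; left; split=> //; rewrite val_insubd uL.
  + apply: NbrTurn => //=; right; split=> //.
    by rewrite val_insubd (ltn_trans _ uL).
  + by apply: NbrUp => //=; rewrite val_insubd ltnS kn.
- by apply: NbrCap => //; rewrite partner_val.
- have kn : (a.2.-1 < n)%N by lia.
  have uL := nth_es_lt kn.
  case: eqP => au; [|case: eqP => au1].
  + by apply: NbrTurn => //=; [lia|left; split=> //; rewrite val_insubd uL].
  + apply: NbrTurn => //=; [lia|right; split=> //].
    by rewrite val_insubd (ltn_trans _ uL).
  + apply: NbrDown => //=; first by rewrite lt0n; apply/eqP.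
    by rewrite val_insubd (leq_ltn_trans (leq_pred _) (ltn_ord _)).
Qed.

Lemma nbr_cap a b e : a.2 = (if e then n else 0%N) :> nat ->
  b.1 = mate a.1 :> nat -> b.2 = a.2 :> nat -> nbr a e = (b, e).
Proof.
move=> ak b1 b2; rewrite /nbr; case: e ak => ->; rewrite eqxx;
  by congr (_, _); apply: atomP; rewrite //= partner_val.
Qed.

Lemma nbr_turn a b e u : (if e then a.2 < n else 0 < a.2)%N ->
  u = nth 0%N es (if e then a.2 : nat else a.2.-1) ->
  (a.1 = u :> nat /\ b.1 = u.+1 :> nat) \/ (a.1 = u.+1 :> nat /\ b.1 = u :> nat) ->
  b.2 = a.2 :> nat -> nbr a e = (b, e).
Proof.
have := ltn_ord b.1; have := ltn_ord b.2; rewrite ltnS => b2n b1L.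
move=> ak ue ab b2; rewrite /nbr; case: e ak ue => ak <-;
  rewrite ifF; try by apply/eqP; lia.
- case: ab => -[-> b1]; rewrite ?eqxx ?ifF; try by apply/eqP; lia.
  + by congr (_, _); apply: atomP; rewrite //= val_insubd -b1 b1L.
  + by congr (_, _); apply: atomP; rewrite //= val_insubd -b1 b1L.
- case: ab => -[-> b1]; rewrite ?eqxx ?ifF; try by apply/eqP; lia.
  + by congr (_, _); apply: atomP; rewrite //= val_insubd -b1 b1L.
  + by congr (_, _); apply: atomP; rewrite //= val_insubd -b1 b1L.
Qed.

Lemma nbr_up a b : (a.2 < n)%N -> a.1 <> nth 0%N es a.2 :> nat ->
  a.1 <> (nth 0%N es a.2).+1 :> nat -> b.1 = a.1 :> nat -> b.2 = a.2.+1 :> nat ->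
  nbr a true = (b, false).
Proof.
move=> an /eqP/negbTE a1 /eqP/negbTE a2 b1 b2; rewrite /nbr a1 a2.
rewrite ifF; last by apply/eqP; lia.
by congr (_, _); apply: atomP; rewrite //= val_insubd ltnS an b2.
Qed.

Lemma nbr_down a b : (0 < a.2)%N -> a.1 <> nth 0%N es a.2.-1 :> nat ->
  a.1 <> (nth 0%N es a.2.-1).+1 :> nat -> b.1 = a.1 :> nat -> b.2 = a.2.-1 :> nat ->
  nbr a false = (b, true).
Proof.
move=> an /eqP/negbTE a1 /eqP/negbTE a2 b1 b2; rewrite /nbr a1 a2.
rewrite ifF; last by apply/eqP; lia.
congr (_, _); apply: atomP; rewrite //= val_insubd b2.
by rewrite (leq_ltn_trans (leq_pred _) (ltn_ord _)).
Qed.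

(** Caps and U-turns keep the side and exchange two columns; a straight gluing exchanges the top of
    a slab with the bottom of the next one. Hence every path can be run backwards. *)
Lemma nbrK a e : nbr (nbr a e).1 (nbr a e).2 = (a, e).
Proof.
case: (nbrP a e) => /= [e1 b ak b1 b2|e1 b u ak ue ab b2|b u ak ue a1 a2 b1 b2|b u ak ue a1 a2 b1 b2].
- by apply: nbr_cap; rewrite ?b2 ?b1 ?mateK.
- apply: (@nbr_turn _ _ _ u); rewrite ?b2 //.
  by case: ab => -[-> ->]; [right|left].
- by apply: nbr_down; rewrite ?b2 ?b1 //= -ue.
- by apply: nbr_up; rewrite ?b2 ?b1 // ?prednK // ?(leq_ltn_trans (leq_pred _)) -?ue //; have := ltn_ord a.2; lia.
Qed.

Definition follow tau a := (nbr a (tau a)).1.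

Lemma consistentP tau : reflect
  (forall a e, tau (nbr a e).1 = if (nbr a e).2 == e then ~~ tau a else tau a)
  (consistent tau).
Proof.
apply: (iffP forallP) => [H a e|H a].
  have /forallP/(_ e) := H a; case: (nbr a e) => b e' /=.
  rewrite eq_sym; case: ifP => _; last by move/eqP.
  by case: (tau b) (tau a) => -[].
apply/forallP => e; have := H a e; case: (nbr a e) => b e' /=.
by rewrite eq_sym; case: ifP => _ ->; rewrite ?eqxx //; case: (tau a).
Qed.

Section Consistent.
Variable tau : pspin L es.
Hypothesis tauC : consistent tau.

(* A consistent path leaving [a] enters the next atom at the end opposite to the
   one through which it will leave. *)
Lemma follow_tau a : (nbr a (tau a)).2 = ~~ tau (follow tau a).
Proof.
rewrite /follow (consistentP _ tauC).
by case: (nbr a (tau a)).2; case: (tau a).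
Qed.

(** The gluing being an involution, the predecessor of [a] is glued to the end of [a] opposite to
    its exit. *)
Lemma follow_prev a : follow tau (nbr a (~~ tau a)).1 = a.
Proof.
have := nbrK a (~~ tau a); rewrite /follow (consistentP _ tauC).
by case: (nbr a (~~ tau a)) => b e' /=; case: e'; case: (tau a) => /= ->.
Qed.

Lemma follow_inj : injective (follow tau).
Proof.
move=> a b ab; have := nbrK a (tau a); have := nbrK b (tau b).
by rewrite !follow_tau -/(follow tau a) -/(follow tau b) ab => -> [].
Qed.

(** Each adjacency is a forward or a backward step of [follow], and the orbits of an injective map
    on a finite set are cycles. *)
Lemma connect_adj a b : connect (@adj L es) a b = fconnect (follow tau) a b.
Proof.
apply/idP/idP; last first.
  apply: connect_sub => {}a {}b /eqP <-; apply: connect1.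
  by apply/existsP; exists (tau a).
apply: connect_sub => {}a {}b /existsP[e /eqP <-].
have [->|ne] := eqVneq e (tau a); first exact: fconnect1.
have -> : e = ~~ tau a by move: ne; case: e (tau a) => -[].
rewrite fconnect_sym; last exact: follow_inj.
by have := fconnect1 (follow tau) (nbr a (~~ tau a)).1; rewrite follow_prev.
Qed.

End Consistent.

(** Reference orientation, up on even and down on odd columns. It is consistent because caps and
    rungs join columns of opposite parity. *)
Definition tau0 : pspin L es := [ffun a : atom L es => ~~ odd (a.1 : nat)].

Lemma tau0_consistent : consistent tau0.
Proof.
apply/consistentP => a e; rewrite !ffunE.
case: (nbrP a e) => /= [e1 b ak b1 b2|e1 b u ak ue ab b2|b u ak ue a1 a2 b1 b2|b u ak ue a1 a2 b1 b2]; rewrite ?eqxx.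
- by rewrite b1 /mate; case: ifP => /= ov; [lia|rewrite ov].
- by case: ab => -[-> ->]; rewrite /= negbK.
- by rewrite b1.
- by rewrite b1.
Qed.

End Gluing.

(** * Insertion of an arc between neighbouring columns *)

Section Cup.
Local Open Scope nat_scope.

(** Seen from above a rung, its upper horizontal segment is a new arc from [u] to [u.+1]. *)
Definition cup (u : nat) (p : nat -> nat) v :=
  if v == u then u.+1 else if v == u.+1 then u else p v.

Lemma eq_matching (F G : pred nat) p : F =1 G -> matching F p -> matching G p.
Proof.
move=> FG [pF pK po nc]; split=> [v|v|v|v w]; rewrite -!FG;
  [exact: pF|exact: pK|exact: po|exact: nc].
Qed.

Lemma matching_cup (F : pred nat) u p : F u -> F u.+1 ->
  matching (fun v => [&& F v, v != u & v != u.+1]) p -> matching F (cup u p).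
Proof.
move=> Fu Fu1 [pF pK po nc].
have key v : F v -> [\/ v = u /\ cup u p v = u.+1, v = u.+1 /\ cup u p v = u
  | [/\ v <> u, v <> u.+1, cup u p v = p v & [&& F v, v != u & v != u.+1]]].
  move=> Fv; rewrite /cup; case: eqP => [->|vu]; first by constructor 1.
  case: eqP => [->|vu1]; first by constructor 2.
  by constructor 3; split=> //; rewrite Fv.
split=> [v Fv|v Fv|v Fv|v w Fv Fw].
- by have [[_ ->]|[_ ->]|[_ _ ->] /pF/and3P[]] := key _ Fv.
- have [[-> ->]|[-> ->]|[? ? -> Fv']] := key _ Fv.
  + by rewrite /cup eqxx ifF //; apply/eqP; lia.
  + by rewrite /cup eqxx.
  + by have /and3P[_ /negbTE h /negbTE h'] := pF _ Fv'; rewrite /cup h h' pK.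
- have [[-> ->]|[-> ->]|[? ? -> /po->]] := key _ Fv => //=.
  by rewrite negbK.
- clear Fu Fu1 po; have [[-> ->]|[-> ->]|[? ? -> Fv']] := key _ Fv;
  have [[-> ->]|[-> ->]|[? ? -> Fw']] := key _ Fw; try (exact: nc);
  clear pK nc key; try (by have /and3P[_ /eqP ? /eqP ?] := pF _ Fv'; lia);
  try (by have /and3P[_ /eqP ? /eqP ?] := pF _ Fw'; lia); lia.
Qed.

Lemma matching_mate m : matching (fun v => v < m.*2) mate.
Proof.
split=> [v|v|v|v w]; rewrite ?mateK //.
- by rewrite /mate; case: ifP; lia.
- by rewrite /mate; case: v => // v _ /=; case ov: (odd v); rewrite /= ?ov.
- by rewrite /mate => _ _; case: ifP; lia.
Qed.

End Cup.

(** * Total turning of a loop, by sweeping the diagram upwards *)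

Section Umlauf.
Variables (L : nat) (es : seq nat).
Hypothesis es_lt : all (fun u => u.+1 < L.*2)%N es.
Local Notation n := (size es).
Local Notation step := (follow (tau0 L es)).
Implicit Types (a b x y z : atom L es).

(** Turnings are kept in the integers, where linear arithmetic decides them, and are cast to [R]
    only at the end. *)
Definition turnz a : int :=
  let: (b, e') := nbr a (tau0 L es a) in
  if e' == tau0 L es a then 2 * spin (tau0 L es a) * (a.1%:Z - b.1%:Z) else 0.

Lemma step_turnz a b e : nbr a (tau0 L es a) = (b, e) -> step a = b /\
  turnz a = if e == tau0 L es a then 2 * spin (tau0 L es a) * (a.1%:Z - b.1%:Z) else 0.
Proof. by rewrite /follow /turnz => ->. Qed.

Lemma atom_ex v k : (v < L.*2)%N -> (k <= n)%N ->
  exists a, a.1 = v :> nat /\ a.2 = k :> nat.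
Proof. by move=> vL kn; exists (Ordinal vL, @Ordinal n.+1 k kn). Qed.

(* The caps at the top are processed one after the other, after the rungs:
   [rank a] is the stage at which the top end of the atom [a] is glued. *)
Definition rank a := if (a.2 < n)%N then a.2 : nat else (n + (a.1)./2)%N.
(** Columns still open upwards at stage [K]: all of them until the rungs are used up, then those to
    the right of the [K - n] caps already closed. The next gluing has [joint K] as its left
    column. *)
Definition frontier K v := ((v < L.*2) && ((K - n).*2 <= v))%N.
Definition joint K := if (K < n)%N then nth 0%N es K else (K - n).*2.
Definition below K : pred (atom L es) := fun a => (rank a < K)%N.

Lemma rank_lt a : (rank a < n + L)%N.
Proof.
have := ltn_ord a.1; have := ltn_ord a.2.
by rewrite /rank; case: ifP => ? ? ?; lia.
Qed.

Lemma rank_frontier a : a.2 = minn (rank a) n :> nat /\ frontier (rank a) a.1.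
Proof.
have := ltn_ord a.1; have := ltn_ord a.2.
by rewrite /rank /frontier; case: ifP => ? ? ?; split; lia.
Qed.

Lemma frontier_rank K a : a.2 = minn K n :> nat -> frontier K a.1 -> (K <= rank a)%N.
Proof. by rewrite /frontier /rank; case: ifP; lia. Qed.

Lemma joint_lt K : (K < n + L)%N -> frontier K (joint K) /\ frontier K (joint K).+1.
Proof.
rewrite /frontier /joint => KL; case: ifP => Kn; last by split; lia.
by have := nth_es_lt es_lt Kn; move: (nth _ _ _) => u; split; lia.
Qed.

Lemma step_joint K x y : (K < n + L)%N -> x.2 = minn K n :> nat ->
  y.2 = minn K n :> nat -> ~~ odd x.1 ->
  x.1 = joint K :> nat /\ y.1 = (joint K).+1 :> nat \/
  x.1 = (joint K).+1 :> nat /\ y.1 = joint K :> nat ->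
  [/\ step x = y, turnz x = 2 * (x.1%:Z - y.1%:Z), rank x = K & rank y = K].
Proof.
move=> KL x2 y2 ox xy.
have tx : tau0 L es x = true by rewrite ffunE.
have xyE : nbr x (tau0 L es x) = (y, true).
  rewrite tx; move: xy; rewrite /joint; case: ifP => Kn xy.
  - have K2 : x.2 = K :> nat by rewrite x2; lia.
    apply: (@nbr_turn L es _ _ _ _ (nth 0%N es K)); rewrite ?K2 //; lia.
  - apply: nbr_cap => //; first by rewrite x2; lia.
    + by rewrite /mate (negbTE ox); lia.
    + by rewrite x2 y2.
have [sx ->] := step_turnz xyE; split=> //; first by rewrite tx /= mulr1.
- by move: xy; rewrite /rank /joint x2; case: ifP => ?; case: ifP => ?; lia.
- by move: xy; rewrite /rank /joint y2; case: ifP => ?; case: ifP => ?; lia.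
Qed.

Lemma step_up a b : (a.2 < n)%N -> ~~ odd a.1 -> a.1 != joint a.2 :> nat ->
  a.1 != (joint a.2).+1 :> nat -> b.1 = a.1 :> nat -> b.2 = a.2.+1 :> nat ->
  step a = b /\ turnz a = 0.
Proof.
rewrite /joint => an; rewrite an => oa /eqP a1 /eqP a2 b1 b2.
have ta : tau0 L es a = true by rewrite ffunE.
have /step_turnz[] : nbr a (tau0 L es a) = (b, false) by rewrite ta; exact: nbr_up.
by rewrite ta.
Qed.

Lemma step_down a b : (0 < a.2)%N -> odd a.1 -> a.1 != joint a.2.-1 :> nat ->
  a.1 != (joint a.2.-1).+1 :> nat -> b.1 = a.1 :> nat -> b.2 = a.2.-1 :> nat ->
  step a = b /\ turnz a = 0.
Proof.
rewrite /joint => a0; rewrite ifT; last by have := ltn_ord a.2; lia.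
move=> oa /eqP a1 /eqP a2 b1 b2.
have ta : tau0 L es a = false by rewrite ffunE oa.
have /step_turnz[] : nbr a (tau0 L es a) = (b, true) by rewrite ta; exact: nbr_down.
by rewrite ta.
Qed.

Lemma step_cup K a b : (K < n)%N -> odd a.1 -> a.2 = K.+1 :> nat -> b.2 = K.+1 :> nat ->
  a.1 = joint K :> nat /\ b.1 = (joint K).+1 :> nat \/
  a.1 = (joint K).+1 :> nat /\ b.1 = joint K :> nat ->
  step a = b /\ turnz a = arc_turn a.1 b.1.
Proof.
rewrite /joint => Kn; rewrite Kn => oa a2 b2 ab.
have ta : tau0 L es a = false by rewrite ffunE oa.
have /step_turnz[-> ->] : nbr a (tau0 L es a) = (b, false).
  by rewrite ta; apply: (@nbr_turn L es _ _ _ _ (nth 0%N es K)); rewrite ?a2 ?b2.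
by split=> //; rewrite ta /arc_turn /=; case: ab => -[-> ->]; case: ltnP; lia.
Qed.

Lemma step_bottom a b : odd a.1 -> a.2 = 0%N :> nat -> b.2 = 0%N :> nat ->
  b.1 = mate a.1 :> nat -> step a = b /\ turnz a = arc_turn a.1 b.1.
Proof.
move=> oa a2 b2 ab.
have ta : tau0 L es a = false by rewrite ffunE oa.
have /step_turnz[-> ->] : nbr a (tau0 L es a) = (b, false).
  by rewrite ta; apply: nbr_cap; rewrite ?a2 ?b2.
split=> //; rewrite ta /arc_turn /= ab /mate oa; case: ltnP; lia.
Qed.

(** Invariant of the sweep: a path going down from the frontier at an odd column comes back up at
    the column given by [p], visits in between only atoms whose top is already glued, and turns like
    a single arc. *)
Definition arcs K (p : nat -> nat) := forall a b,
  a.2 = minn K n :> nat -> b.2 = minn K n :> nat -> frontier K a.1 -> odd a.1 ->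
  b.1 = p a.1 :> nat -> reach step turnz (below K) a b (arc_turn a.1 b.1).

(** An old arc ending at the joint continues through the U-turn into a second old arc, along [a],
    [x], [y], [b]; by [matching_join_sgn] the three turnings add up to that of one arc. *)
Lemma arcs_join K p a b (u := joint K) : (K < n + L)%N ->
  matching (frontier K) p -> arcs K p ->
  a.2 = minn K n :> nat -> b.2 = minn K n :> nat -> frontier K a.1 -> odd a.1 ->
  a.1 != u :> nat -> a.1 != u.+1 :> nat -> b.1 = join u p a.1 :> nat ->
  reach step turnz (below K.+1) a b (arc_turn a.1 b.1).
Proof.
move=> KL mp ap a2 b2 Fa oa au au1.
have [Fu Fu1] := joint_lt KL; have [pF pK po nc] := mp.
have [s1 s2] := matching_join_sgn mp Fu Fu1 Fa au au1.
have below1 x : below K x -> below K.+1 x by rewrite /below => /ltnW.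
have kn : (minn K n <= n)%N by rewrite geq_minr.
have FL v : frontier K v -> (v < L.*2)%N by case/andP.
have [x [x1 x2]] := atom_ex (FL _ (pF _ Fa)) kn.
have ax := ap _ _ a2 x2 Fa oa x1.
have ox : ~~ odd x.1 by rewrite x1 po // oa.
rewrite /join; case: eqP => [pu|pnu] b1; last case: eqP b1 => [pu1|pnu1] b1.
- have [y [y1 y2]] := atom_ex (FL _ Fu1) kn.
  have [sx tx rx ry] : [/\ step x = y, turnz x = 2 * (x.1%:Z - y.1%:Z), rank x = K & rank y = K].
    by apply: step_joint => //; left; rewrite x1 y1 pu.
  have yb : reach step turnz (below K) y b (arc_turn y.1 b.1).
    by apply: ap; rewrite ?y1 //=; rewrite -/u -pu po // oa.
  have -> : arc_turn a.1 b.1 = arc_turn a.1 x.1 + (turnz x + arc_turn y.1 b.1).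
    rewrite tx x1 y1 b1 -(s1 pu) pu -/u -addrA; congr (_ + (_ + _)); lia.
  apply: reach_trans (reachW below1 ax) _ _; first by rewrite /below rx.
  apply: reach_trans (reachW below1 yb); last by rewrite /below ry.
  by rewrite -sx; exact: reach_step.
- have [y [y1 y2]] := atom_ex (FL _ Fu) kn.
  have [sx tx rx ry] : [/\ step x = y, turnz x = 2 * (x.1%:Z - y.1%:Z), rank x = K & rank y = K].
    by apply: step_joint => //; right; rewrite x1 y1 pu1.
  have yb : reach step turnz (below K) y b (arc_turn y.1 b.1).
    apply: ap; rewrite ?y1 //=; have : ~~ odd u.+1 by rewrite -pu1 po // oa.
    by rewrite /= negbK.
  have -> : arc_turn a.1 b.1 = arc_turn a.1 x.1 + (turnz x + arc_turn y.1 b.1).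
    rewrite tx x1 y1 b1 -(s2 pu1) pu1 -/u -addrA; congr (_ + (_ + _)); lia.
  apply: reach_trans (reachW below1 ax) _ _; first by rewrite /below rx.
  apply: reach_trans (reachW below1 yb); last by rewrite /below ry.
  by rewrite -sx; exact: reach_step.
- have -> : b = x by apply: atomP; rewrite ?b1 ?x1 ?b2 ?x2.
  exact: reachW ax.
Qed.

Lemma arcs_ex K : (K <= n + L)%N -> exists2 p, matching (frontier K) p & arcs K p.
Proof.
elim: K => [_|K IH KL].
  exists mate.
    by apply: eq_matching (matching_mate L) => v; rewrite /frontier sub0n andbT.
  move=> a b; rewrite min0n => a2 b2 _ oa ab.
  by have [<- <-] := step_bottom oa a2 b2 ab; exact: reach_step.
have [p mp ap] := IH (ltnW KL).
have [Fu Fu1] := joint_lt KL; have mj := matching_join mp Fu Fu1.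
have aj := arcs_join KL mp ap.
(* A cap removes two columns from the frontier. At a rung they reappear one slab higher, joined by
   the arc of [cup]. *)
have [nK|Kn] := leqP n K.
  have uE : joint K = (K - n).*2 by rewrite /joint ltnNge nK.
  have FE : (fun v => [&& frontier K v, v != joint K & v != (joint K).+1]) =1 frontier K.+1.
    by move=> v; rewrite uE /frontier; lia.
  have minE : minn K.+1 n = minn K n by lia.
  exists (join (joint K) p); first exact: eq_matching mj.
  move=> a b; rewrite minE -FE => a2 b2 /and3P[Fa au au1] oa ab.
  exact: aj.
have FE : frontier K.+1 =1 frontier K by move=> v; rewrite /frontier; lia.
have m1 : minn K.+1 n = K.+1 by lia.
have m0 : minn K n = K by lia.
exists (cup (joint K) (join (joint K) p)).
  by apply: eq_matching (fsym FE) _; exact: matching_cup.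
move=> a b; rewrite m1 FE => a2 b2 Fa oa; rewrite /cup.
case: eqP => [au b1|/eqP au]; last case: eqP => [au1 b1|/eqP au1 b1].
- have [<- <-] : step a = b /\ turnz a = arc_turn a.1 b.1 by apply: (step_cup Kn) => //; left.
  exact: reach_step.
- have [<- <-] : step a = b /\ turnz a = arc_turn a.1 b.1 by apply: (step_cup Kn) => //; right.
  exact: reach_step.
(* Every other arc is the one from [x] to [y] one slab below, prolonged by two vertical pieces
   without turning. *)
have [/(_ a.1) + _ _ _] := mj; rewrite Fa au au1 -b1 => /(_ isT) /and3P[Fb bu bu1].
have [x [x1 x2]] := atom_ex (ltn_ord a.1) (ltnW Kn).
have [y [y1 y2]] := atom_ex (ltn_ord b.1) (ltnW Kn).
have xy : reach step turnz (below K.+1) x y (arc_turn x.1 y.1).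
  by apply: aj; rewrite ?m0 ?x1 ?y1.
have ob : ~~ odd b.1.
  by have [_ _ /(_ a.1) + _] := mj; rewrite Fa au au1 -b1 => /(_ isT) ->; rewrite oa.
have [sa ta] : step a = x /\ turnz a = 0.
  by apply: step_down; rewrite ?a2 ?x1 ?x2.
have [sy ty] : step y = b /\ turnz y = 0.
  by apply: step_up; rewrite ?y2 ?y1 ?b2.
have -> : arc_turn a.1 b.1 = turnz a + (arc_turn x.1 y.1 + turnz y).
  by rewrite ta ty add0r addr0 x1 y1.
have rx : rank x = K by rewrite /rank x2 Kn.
have ry : rank y = K by rewrite /rank y2 Kn.
apply: (@reach_trans _ _ _ _ _ _ x); [|by rewrite /below rx|].
  by rewrite -sa; exact: reach_step.
apply: reach_trans xy _ _; first by rewrite /below ry.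
by rewrite -sy; exact: reach_step.
Qed.

(* The gluing of maximal rank along a loop closes an arc of turning +-2 by a
   U-turn in the same direction. *)
Lemma loop_turnz a :
  let s := \sum_(x | fconnect step a x) turnz x in s = 4 \/ s = - 4.
Proof.
have tC := tau0_consistent es_lt.
have sI : injective step by exact: follow_inj.
have sS x y : fconnect step x y = fconnect step y x by exact: fconnect_sym.
case: (arg_maxnP rank (connect0 (frel step) a)) => x ax xmax.
set K := rank x in xmax.
have KL : (K < n + L)%N := rank_lt x.
have [p mp ap] := arcs_ex (ltnW KL).
have [Fu Fu1] := joint_lt KL; have [pF pK po nc] := mp.
have FL v : frontier K v -> (v < L.*2)%N by case/andP.
have kn : (minn K n <= n)%N by rewrite geq_minr.
pose joins y z := y.1 = joint K :> nat /\ z.1 = (joint K).+1 :> nat \/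
  y.1 = (joint K).+1 :> nat /\ z.1 = joint K :> nat.
(* At maximal rank an upward path cannot go straight on, since the next atom would have a larger
   rank; so it takes the U-turn of stage [K]. *)
have up y : fconnect step a y -> rank y = K -> ~~ odd y.1 ->
    exists z, [/\ z.2 = minn K n :> nat, joins y z, odd z.1, step y = z
      & turnz y = 2 * (y.1%:Z - z.1%:Z)].
  move=> ay ry oy.
  have [] := rank_frontier y; rewrite ry => y2 Fy.
  have yu : y.1 = joint K :> nat \/ y.1 = (joint K).+1 :> nat.
    have [nK|Kn] := leqP n K.
      by move: ry; rewrite /rank /joint y2 !ifF; lia.
    have [->|yu] := eqVneq (y.1 : nat) (joint K); first by left.
    have [->|yu1] := eqVneq (y.1 : nat) (joint K).+1; first by right.
    have y2K : y.2 = K :> nat by rewrite y2; lia.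
    have [z [z1 z2]] := atom_ex (ltn_ord y.1) Kn.
    have [yz _] : step y = z /\ turnz y = 0 by apply: step_up; rewrite ?y2K.
    have /xmax : fconnect step a z.
      by apply: connect_trans ay _; rewrite -yz; exact: fconnect1.
    by rewrite /rank z2; case: ifP; lia.
  have [z [z2 yz]] : exists z, z.2 = minn K n :> nat /\ joins y z.
    case: yu => yu.
      by have [z [? ?]] := atom_ex (FL _ Fu1) kn; exists z; split=> //; left.
    by have [z [? ?]] := atom_ex (FL _ Fu) kn; exists z; split=> //; right.
  have [? ? _ _] := step_joint KL y2 z2 oy yz.
  exists z; split=> //.
  by move: oy; case: yz => -[-> ->] /=; rewrite ?negbK.
(* A downward path returns along an arc to the frontier, where ranks are at least [K]; by maximality
   the rank is again [K]. *)
have down y : fconnect step a y -> rank y = K -> odd y.1 ->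
    exists z, [/\ fconnect step a z, rank z = K, ~~ odd z.1
      & reach step turnz (below K) y z (arc_turn y.1 z.1)].
  move=> ay ry oy.
  have [] := rank_frontier y; rewrite ry => y2 Fy.
  have [z [z1 z2]] := atom_ex (FL _ (pF _ Fy)) kn.
  have yz := ap _ _ y2 z2 Fy oy z1.
  have az : fconnect step a z.
    apply: connect_trans ay _; case: yz => m [<- _ _]; exact: fconnect_iter.
  exists z; split=> //; last by rewrite z1 po // oy.
  apply/eqP; rewrite eqn_leq frontier_rank ?z1 ?pF // andbT.
  exact: xmax.
have [y [ay ry oy yj]] : exists y, [/\ fconnect step a y, rank y = K, odd y.1
    & y.1 = joint K :> nat \/ y.1 = (joint K).+1 :> nat].
  have [y [ay ry oy]] : exists y, [/\ fconnect step a y, rank y = K & ~~ odd y.1].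
    have [ox|ox] := boolP (odd x.1); last by exists x.
    by have [y [? ? ? _]] := down x ax erefl ox; exists y.
  have [z [z2 yz oz sy _]] := up y ay ry oy; exists z; split => //.
  - by apply: connect_trans ay _; rewrite -sy; exact: fconnect1.
  - have [] := rank_frontier y; rewrite ry => y2 _.
    by have [] := step_joint KL y2 z2 oy yz.
  - by case: yz => -[_ ->]; [right|left].
have [z [az rz oz yz]] := down y ay ry oy.
have [w [w2 zw ow sz tz]] := up z az rz oz.
(* Only one of the two columns at the joint is odd, so the U-turn leads back to [y] and the loop
   consists of one arc and one U-turn. *)
have wy : w = y.
  apply: atomP; last by have [-> _] := rank_frontier y; rewrite w2 ry.
  move: ow oz oy; case: zw => -[-> ->]; case: yj => -> //=; by case: (odd _).
have yy : reach step turnz (predC1 y) y y (arc_turn y.1 z.1 + turnz z).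
  have below_y b : below K b -> b != y.
    by apply: contraL => /eqP ->; rewrite /below ry ltnn.
  apply: reach_trans (reachW below_y yz) _ _.
    by apply: contraNneq oz => ->.
  by rewrite -{2}wy -sz; exact: reach_step.
have /= -> : \sum_(x | fconnect step a x) turnz x = arc_turn y.1 z.1 + turnz z.
  have yD : ~~ predC1 y y by rewrite /= eqxx.
  rewrite -(reach_loop sI yy yD); apply: eq_bigl => b.
  by apply/idP/idP; apply: connect_trans; rewrite // sS.
rewrite tz wy /arc_turn; case: zw; rewrite wy => -[-> ->]; case: ltnP => ?; first [left; lia | right; lia].
Qed.
End Umlauf.

(** * Loop weights *)

Section LoopWeights.
Variables (R : realType) (L : nat) (es : seq nat).
Hypothesis es_lt : all (fun u => u.+1 < L.*2)%N es.
Implicit Types (a b : atom L es) (tau : pspin L es).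
Local Notation t0 := (tau0 L es).

Definition loop_of a : {set atom L es} := [set b | connect (@adj L es) a b].

Lemma adj_sym a b : connect (@adj L es) a b = connect (@adj L es) b a.
Proof.
rewrite !(connect_adj es_lt (tau0_consistent es_lt)) fconnect_sym //.
exact: follow_inj (tau0_consistent es_lt).
Qed.

Lemma loop_of_eq a b : (b \in loop_of a) = (loop_of b == loop_of a).
Proof.
apply/idP/eqP => [|<-]; rewrite inE // => ab.
by apply/setP => c; rewrite !inE (same_connect adj_sym ab).
Qed.

Lemma loop_of_nbr a e : loop_of (nbr a e).1 = loop_of a.
Proof.
by apply/eqP; rewrite -loop_of_eq inE connect1 //; apply/existsP; exists e.
Qed.

Lemma in_loop_nbr a b e : ((nbr b e).1 \in loop_of a) = (b \in loop_of a).
Proof. by rewrite !loop_of_eq loop_of_nbr. Qed.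

Lemma loop_of_in a : loop_of a \in loops L es.
Proof. exact: imset_f. Qed.

Lemma in_loop (l : {set atom L es}) a : l \in loops L es -> (a \in l) = (loop_of a == l).
Proof. by case/imsetP => b _ ->; rewrite -loop_of_eq. Qed.

Lemma sum_loops (F : atom L es -> R) :
  \sum_a F a = \sum_(l in loops L es) \sum_(a in l) F a.
Proof.
rewrite (partition_big loop_of (mem (loops L es))) => [|a _]; last exact: loop_of_in.
by apply: eq_bigr => l lL; apply: eq_bigl => a; rewrite in_loop.
Qed.

Lemma turning_tau0 l : l \in loops L es -> turning R t0 l = 4 \/ turning R t0 l = -4.
Proof.
case/imsetP => a _ ->.
have -> : turning R t0 (loop_of a) = (\sum_(x | fconnect (follow t0) a x) turnz x)%:~R.
  rewrite /turning raddf_sum /=; apply: eq_big => [x|x _].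
    by rewrite inE (connect_adj es_lt (tau0_consistent es_lt)).
  rewrite /turn /turnz; case: nbr => b e; case: eqP => // _.
  by rewrite !rmorphM /= rmorphB /=; case: (t0 x).
by case: (loop_turnz es_lt a) => /= ->; [left|right].
Qed.

(** Consistency propagates the comparison with the reference orientation through every gluing, so it
    is constant on each loop. *)
Definition reversed tau a := tau a (+) t0 a.

Lemma reversed_nbr tau a e : consistent tau -> reversed tau (nbr a e).1 = reversed tau a.
Proof.
move=> /consistentP h; have /consistentP h0 := tau0_consistent es_lt.
by rewrite /reversed h h0; case: eqP; case: (tau a) (t0 a) => -[].
Qed.

Lemma reversed_loop tau a b : consistent tau -> b \in loop_of a ->
  reversed tau b = reversed tau a.
Proof.
move=> tC; rewrite inE => /connectP[p + ->] {b}.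
elim: p a => //= c p IH a /andP[/existsP[e /eqP <-]] /IH ->.
exact: reversed_nbr.
Qed.

Lemma turning_loop tau a : consistent tau ->
  turning R tau (loop_of a) = (-1) ^+ reversed tau a * turning R t0 (loop_of a).
Proof.
move=> tC; have t0C := tau0_consistent es_lt.
rewrite /turning; case: (boolP (reversed tau a)) => ra; last first.
  rewrite mul1r; apply: eq_bigr => b /(reversed_loop tC); rewrite (negbTE ra).
  rewrite /reversed /turn => tE; have -> // : tau b = t0 b.
  by move: tE; case: (tau b) (t0 b) => -[].
rewrite mulN1r -sumrN; have rb b : b \in loop_of a -> tau b = ~~ t0 b.
  by move=> /(reversed_loop tC); rewrite ra /reversed; case: (tau b) (t0 b) => -[].
(* The reversed path takes the same U-turns from their other ends, so the sum is reindexed by the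
   glued atom. *)
rewrite [RHS](reindex_onto (fun b => (nbr b (tau b)).1) (follow t0)) /=; last first.
  move=> b bl; have -> : tau (follow t0 b) = ~~ t0 (follow t0 b).
    by apply: rb; rewrite /follow in_loop_nbr.
  by rewrite -follow_tau // nbrK.
apply: eq_big => [b|b bl].
  rewrite in_loop_nbr; case: (boolP (_ \in _)) => //= bl.
  by rewrite rb // follow_prev // eqxx.
rewrite /turn; have := nbrK es_lt b (tau b).
have := follow_tau tC b; rewrite -/(follow tau b).
have -> : ~~ tau (follow tau b) = t0 (follow tau b).
  by rewrite rb ?negbK // /follow in_loop_nbr.
rewrite /follow; case: (nbr b (tau b)) => c e /= -> ->.
case: eqP => [->|ne]; first by rewrite eqxx; ring.
by rewrite ifF ?oppr0 //; apply/eqP => h; apply: ne.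
Qed.

Lemma turning_pm tau l : consistent tau -> l \in loops L es ->
  turning R tau l = 4 \/ turning R tau l = - 4.
Proof.
move=> tC lL; have := turning_tau0 lL; case/imsetP: lL => a _ ->.
rewrite -/(loop_of a) (turning_loop a tC).
case: (reversed tau a) => -[->|->]; rewrite ?expr1 ?expr0.
- by right; ring.
- by left; ring.
- by left; ring.
- by right; ring.
Qed.

(** Every loop turns by [4] or [- 4] quarter turns, so a weight of [lam / 4] per quarter turn gives
    exactly [lam] or [- lam] per loop. *)
Lemma W_loops (lam : R) tau : consistent tau ->
  W true lam tau = \prod_(l in loops L es) expR (lam / 4 * turning R tau l).
Proof.
move=> tC; rewrite /W big_mkcondr [X in _ * X]big_mkcondr -big_split /=.
apply: eq_bigr => l /(turning_pm tC); rewrite /ccw /cw /spin mul1r.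
case=> ->.
- by rewrite ltr0n /= ifF ?mulr1 ?mulfVK //; apply/negbTE; rewrite -leNgt.
- by rewrite oppr_gt0 oppr_lt0 ltr0n /= ifF ?mul1r ?mulrN ?mulfVK //; apply/negbTE; rewrite -leNgt.
Qed.

(** The weight of whole loops becomes a product of local factors, as a transfer matrix requires. *)
Lemma W_turn (lam : R) tau : consistent tau ->
  W true lam tau = \prod_a expR (lam / 4 * turn R tau a).
Proof.
move=> tC; rewrite W_loops // -!expR_sum -!mulr_sumr; congr (expR (_ * _)).
by rewrite sum_loops.
Qed.

(** A consistent pseudo-spin is a free choice, loop by loop, of whether to reverse the reference
    orientation; the two choices have weights [expR lam] and [expR (- lam)] in some order. *)
Lemma sum_W (lam : R) :
  \sum_(tau : pspin L es) (consistent tau)%:R * W true lam tau = sqrtQ lam ^+ nloops L es.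
Proof.
pose E (l : {set atom L es}) (b : bool) := expR (lam / 4 * ((-1) ^+ b * turning R t0 l)).
have EQ l : l \in loops L es -> \sum_b E l b = sqrtQ lam.
  move=> lL; rewrite big_bool /E /sqrtQ /= expr1 expr0.
  have h : lam / 4 * 4 = lam by rewrite mulfVK.
  by case: (turning_tau0 lL) => ->; rewrite ?mul1r ?mulN1r ?opprK ?mulrN h // addrC.
have -> : sqrtQ lam ^+ nloops L es = \prod_(l in loops L es) \sum_b E l b.
  by rewrite (eq_bigr _ EQ) prodr_const.
rewrite (big_distr_big false) /=.
pose tauof (g : {ffun {set atom L es} -> bool}) : pspin L es :=
  [ffun a => g (loop_of a) (+) t0 a].
(* Sets that are not loops get [false], the default value in [big_distr_big], so that this inverts
   [tauof]. *)
pose gof tau : {ffun {set atom L es} -> bool} :=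
  [ffun l => (l \in loops L es) && [exists a in l, reversed tau a]].
have tauofE g a : tauof g a = g (loop_of a) (+) t0 a by rewrite ffunE.
have gofE tau a : consistent tau -> gof tau (loop_of a) = reversed tau a.
  move=> tC; rewrite ffunE loop_of_in /=; apply/idP/idP.
    by case/existsP => b /andP[/(reversed_loop tC) ->].
  by move=> ra; apply/existsP; exists a; rewrite ra loop_of_eq eqxx.
rewrite (eq_bigr (fun tau => if consistent tau then W true lam tau else 0)); last first.
  by move=> tau _; case: (consistent tau); rewrite ?mul1r ?mul0r.
rewrite -big_mkcond /=.
rewrite (reindex_onto tauof gof) => [|tau tC]; last first.
  by apply/ffunP => a; rewrite tauofE gofE // /reversed addbK.
have tauC g : consistent (tauof g).
  apply/consistentP => a e; rewrite !tauofE loop_of_nbr.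
  have /consistentP -> := tau0_consistent es_lt.
  by case: ifP; case: (g _) (t0 a) => -[].
have gtauof g : gof (tauof g) = [ffun l => (l \in loops L es) && g l].
  apply/ffunP => l; rewrite [RHS]ffunE; case: (boolP (l \in loops L es)) => lL; last first.
    by rewrite ffunE (negbTE lL).
  have /imsetP[a _ ->] := lL.
  by rewrite -/(loop_of a) gofE // /reversed tauofE addbK.
apply: eq_big => [g|g _].
  rewrite tauC /= gtauof; apply/eqP/familyP => [<- l|gP].
    by rewrite ffunE /=; case: (l \in loops L es).
  apply/ffunP => l; rewrite ffunE; have := gP l; rewrite /=.
  by case: (l \in loops L es) => //= /eqP ->.
rewrite W_loops //; apply: eq_bigr => l lL; rewrite /E.
have /imsetP[a _ ->] := lL.
by rewrite -/(loop_of a) turning_loop // /reversed tauofE addbK.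
Qed.

End LoopWeights.

(** * The transfer matrix *)

Section Hamiltonian.
Variables (R : realType) (L : nat) (lam : R).
Implicit Types (s : conf L) (b : bond L).

Definition agree_off b s s' := [forall v, (v != bl b) && (v != br b) ==> (s v == s' v)].

(** Temperley-Lieb generator: xi xi^T on the two sites of [b], with xi given by [pair_coef], and the
    identity elsewhere. *)
Definition rung_op b : op R L := fun s s' => (agree_off b s s')%:R *
  pair_coef lam (s (bl b)) (s (br b)) * pair_coef lam (s' (bl b)) (s' (br b)).

Lemma bl_neq_br b : bl b != br b.
Proof. by rewrite -val_eqE /= neq_ltn ltnSn. Qed.

Lemma eq_agree b s s' : (s == s') =
  [&& agree_off b s s', s (bl b) == s' (bl b) & s (br b) == s' (br b)].
Proof.
apply/eqP/and3P => [->|[/forallP a /eqP e1 /eqP e2]].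
  by rewrite !eqxx; split=> //; apply/forallP => v; apply/implyP.
apply/ffunP => v; have := a v; have [->//|_] := eqVneq v (bl b).
by have [->//|_] := eqVneq v (br b); move/eqP.
Qed.

Lemma eq_flip_agree b s s' : (s == flip (bl b) (flip (br b) s')) =
  [&& agree_off b s s', s (bl b) == ~~ s' (bl b) & s (br b) == ~~ s' (br b)].
Proof.
have nb := bl_neq_br b; rewrite (eq_agree b); congr [&& _, _ & _].
- apply: eq_forallb => v; rewrite !ffunE.
  by have [//|_] := eqVneq v (bl b); have [//|_] := eqVneq v (br b).
- by rewrite !ffunE eqxx (negbTE nb).
- by rewrite !ffunE eqxx [br b == bl b]eq_sym (negbTE nb).
Qed.

Lemma tz_at_val (v : site L) s s' : tz_at R v s s' = tz R v s s'.
Proof.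
rewrite /tz_at (bigD1 v) //= big1 ?addr0 // => w /andP[/eqP e /eqP ne].
by case: ne; apply: val_inj.
Qed.

(** The bulk term has the same diagonal entry [coshR lam] on both antiparallel states; the [sinhR]
    term splits it into [expR (- lam)] and [expR lam]. *)
Lemma rung_op_local b s s' : rung_op b s s' =
  1 / 2 * (txtx R (bl b) (br b) s s' + tyty R (bl b) (br b) s s'
      - coshR lam * (tztz R (bl b) (br b) s s' - op_id R s s'))
  - sinhR lam / 2 * (tz R (bl b) s s' - tz R (br b) s s').
Proof.
rewrite /rung_op /txtx /tyty /tztz /tz /op_id eq_flip_agree (eq_agree b) /coshR /sinhR.
have e2 : expR (- lam / 2) * expR (- lam / 2) = expR (- lam).
  by rewrite -expRD -splitr.
have e2' : expR (lam / 2) * expR (lam / 2) = expR lam by rewrite -expRD -splitr.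
have e0 : expR (- lam / 2) * expR (lam / 2) = 1 by rewrite -expRD mulNr addNr expR0.
case: (agree_off b s s'); rewrite /pair_coef /spin; last by rewrite /= !mul0r; field.
rewrite -e2 -e2'; move: (expR (- lam / 2)) (expR (lam / 2)) e0 => x y e0.
by case: (s (bl b)); case: (s (br b)); case: (s' (bl b)); case: (s' (br b)) => /=; lra.
Qed.

Lemma H_XXZ_rung_op s s' : (0 < L)%N -> ~~ odd L ->
  - H_XXZ_pm true lam s s' = \sum_b rung_op b s s'.
Proof.
move=> L0 evL; rewrite (eq_bigr _ (fun b _ => rung_op_local b s s')) sumrB -!mulr_sumr.
have -> : \sum_(b : bond L) (tz R (bl b) s s' - tz R (br b) s s') =
    tz_at R 0 s s' - tz_at R L.*2.-1 s s'.
  rewrite (eq_bigr (fun b : bond L => tz_at R b s s' - tz_at R b.+1 s s')) => [|b _]; last first.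
    by rewrite -(tz_at_val (bl b)) -(tz_at_val (br b)).
  rewrite -(big_mkord xpredT (fun k => tz_at R k s s' - tz_at R k.+1 s s')).
  rewrite -[LHS]opprK -sumrN (eq_bigr (fun k => tz_at R k.+1 s s' - tz_at R k s s')).
    by rewrite telescope_sumr // opprB.
  by move=> k _; rewrite opprB.
by rewrite /H_XXZ_pm /H_XXZ /spin -signr_odd (negbTE evL) expr0; field.
Qed.

End Hamiltonian.

(** * Sums over paths of configurations *)

Section PathSum.
Variables (R : comPzRingType) (S : finType).
Implicit Types (B : nat -> S -> S -> R) (al psi : S -> R).

Fixpoint evolve B al (m : nat) (s : S) : R :=
  if m is m'.+1 then \sum_t B m' s t * evolve B al m' t else al s.

(** The last point of the path is split off, and for each of its values the last kernel is absorbed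
    into [psi], which leaves a path with one step less. *)
Lemma path_sum B al psi m :
  \sum_(p : {ffun 'I_m.+1 -> S})
    al (p ord0) * (\prod_(k < m) B k (p (lift ord0 k)) (p (widen_ord (leqnSn m) k))) *
      psi (p ord_max) =
  \sum_s psi s * evolve B al m s.
Proof.
elim: m psi => [|m IH] psi.
  rewrite (reindex (fun s : S => [ffun _ : 'I_1 => s])) /=; last first.
    exists (fun p : {ffun 'I_1 -> S} => p ord0) => [s _|p _]; first by rewrite ffunE.
    by apply/ffunP => i; rewrite ffunE; congr (p _); apply: val_inj; case: i => -[].
  by apply: eq_bigr => s _; rewrite big_ord0 mulr1 !ffunE mulrC.
pose ext (q : {ffun 'I_m.+1 -> S} * S) : {ffun 'I_m.+2 -> S} :=
  [ffun i => if unlift ord_max i is Some j then q.1 j else q.2].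
have extl q (j : 'I_m.+1) : ext q (widen_ord (leqnSn m.+1) j) = q.1 j.
  rewrite ffunE; have -> : widen_ord (leqnSn m.+1) j = lift ord_max j.
    by apply: val_inj; rewrite /= /bump leqNgt ltn_ord.
  by rewrite liftK.
have extm q : ext q ord_max = q.2 by rewrite ffunE unlift_none.
rewrite (reindex ext) /=; last first.
  exists (fun p => ([ffun j => p (widen_ord (leqnSn m.+1) j)], p ord_max)) => [[q s] _|p _].
    by rewrite extm; congr (_, _); apply/ffunP => j; rewrite ffunE extl.
  apply/ffunP => i; rewrite ffunE; case: unliftP => [j ->|-> //]; rewrite ffunE /=.
  by congr (p _); apply: val_inj; rewrite /= /bump leqNgt ltn_ord.
rewrite -(pair_bigA _ (fun q s => al (ext (q, s) ord0) * (\prod_(k < m.+1) B k (ext (q, s) (lift ord0 k))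
  (ext (q, s) (widen_ord (leqnSn m.+1) k))) * psi (ext (q, s) ord_max))) /= exchange_big /=.
apply: eq_bigr => s _.
rewrite mulr_sumr (eq_bigr _ (fun t _ => mulrA _ _ _)).
rewrite -(IH (fun t => psi s * B m s t)).
apply: eq_bigr => q _; rewrite extm big_ord_recr /=.
have -> : ext (q, s) ord0 = q ord0.
  by rewrite -(extl (q, s)); congr (ext _ _); apply: val_inj.
have -> : ext (q, s) (lift ord0 ord_max) = s.
  by rewrite -[RHS](extm (q, s)); congr (ext _ _); apply: val_inj.
rewrite extl /=.
have -> : \prod_(i < m) B i (ext (q, s) (lift ord0 (widen_ord (leqnSn m) i)))
     (ext (q, s) (widen_ord (leqnSn m.+1) (widen_ord (leqnSn m) i))) =
   \prod_(k < m) B k (q (lift ord0 k)) (q (widen_ord (leqnSn m) k)).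
  apply: eq_bigr => i _; rewrite extl; congr (B _ _ _).
  by rewrite -(extl (q, s)); congr (ext _ _); apply: val_inj.
ring.
Qed.

(* Distributing the product over the steps of a path turns the sum over the
   words [bs] into a single evolution with the summed kernel. *)
Lemma evolve_sum (I : finType) (i0 : I) (A : I -> nat -> S -> S -> R) al psi n :
  \sum_(bs : n.-tuple I) \sum_s psi s * evolve (fun k => A (nth i0 bs k) k) al n s =
  \sum_s psi s * evolve (fun k s t => \sum_i A i k s t) al n s.
Proof.
rewrite -path_sum (eq_bigr _ (fun bs _ => esym (path_sum _ _ _ _))) exchange_big /=.
apply: eq_bigr => p _; rewrite -mulr_suml -mulr_sumr; congr (_ * _ * _).
rewrite bigA_distr_bigA (reindex (fun g : {ffun 'I_n -> I} => mktuple g)); last first.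
  exists (fun t : n.-tuple I => [ffun i => tnth t i]) => [g _|t _].
    by apply/ffunP => i; rewrite ffunE tnth_mktuple.
  by apply: eq_from_tnth => i; rewrite tnth_mktuple ffunE.
by apply: eq_bigr => g _; apply: eq_bigr => k _; rewrite -tnth_nth tnth_mktuple.
Qed.

End PathSum.

(** * Loop weights as products over time slabs *)

Section TransferWeight.
Variables (R : realType) (L : nat) (lam : R) (bs : seq (bond L)).
Local Notation es := [seq nat_of_ord b | b <- bs].
Local Notation n := (size es).
Implicit Types (tau : pspin L es) (a : atom L es).

Lemma bonds_lt (cs : seq (bond L)) :
  all (fun u => u.+1 < L.*2)%N [seq nat_of_ord b | b <- cs].
Proof. by apply/allP => _ /mapP[b _ ->]; exact: bond_lt. Qed.

(* Contribution of the end [e] of the atom [a]. A U-turn is counted at the end through which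
   the path leaves its atom, so the two ends glued on one side of a rung contribute together
   one factor [pair_coef]. *)
Definition half tau e a : R := let: (b, e') := nbr a e in
  if e == e' then (tau b != tau a)%:R *
    (if tau a == e then expR (lam / 4 * (2 * spin e * ((a.1 : nat)%:R - (b.1 : nat)%:R))) else 1)
  else (tau b == tau a)%:R.

(** A violated gluing makes its own [half] vanish. For a consistent [tau], only the end through
    which the path leaves an atom carries an exponential. *)
Lemma weight_half tau :
  (consistent tau)%:R * \prod_a expR (lam / 4 * turn R tau a) =
  \prod_a (half tau false a * half tau true a).
Proof.
case: (boolP (consistent tau)) => [tC|].
  rewrite mul1r; apply: eq_bigr => a _.
  have /consistentP tP := tC.
  have := tP a false; have := tP a true; rewrite /half /turn.
  case ta: (tau a); case: (nbr a true) => b []; case: (nbr a false) => c [] /= -> ->;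
    by rewrite ?ta /= ?mul1r ?mulr1 ?mulr0 ?expR0.
rewrite negb_forall => /existsP[a]; rewrite negb_forall => /existsP[e ae].
rewrite mul0r (bigD1 a) //=; suff -> : half tau false a * half tau true a = 0 by rewrite mul0r.
suff h : half tau e a = 0 by case: e h {ae} => ->; rewrite ?mul0r ?mulr0.
rewrite /half; case: (nbr a e) ae => b e'; case: ifP => _ /negbTE ->; by rewrite ?mul0r.
Qed.

Definition slice tau (k : 'I_n.+1) : conf L := [ffun v => tau (v, k)].

Lemma half_turn tau e a b : nbr a e = (b, e) -> half tau e a = (tau b != tau a)%:R *
  (if tau a == e then expR (lam / 4 * (2 * spin e * ((a.1 : nat)%:R - (b.1 : nat)%:R))) else 1).
Proof. by rewrite /half => ->; rewrite eqxx. Qed.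

Lemma half_straight tau e a b : nbr a e = (b, ~~ e) -> half tau e a = (tau b == tau a)%:R.
Proof. by rewrite /half => ->; case: e. Qed.

Lemma quarter (x y : R) : lam / 4 * (2 * x * y) = lam / 2 * (x * y).
Proof. by field. Qed.

Lemma odd_partner (v : site L) : odd (partner v) = ~~ odd v.
Proof. by rewrite partner_val /mate; case: v => -[|v] vL //=; case ov: (odd v); rewrite /= ?ov. Qed.

(** Each cap has two ends, brought together by pairing an odd column with its even partner. Exactly
    one of them is an exit, and it carries the exponent [lam / 2] with the sign of the turn. *)
Lemma seed_half tau e (k : 'I_n.+1) : k = (if e then n else 0%N) :> nat ->
  \prod_v half tau e (v, k) = seed lam (slice tau k).
Proof.
move=> ke; rewrite (bigID (fun v : site L => ~~ odd v)) /=.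
rewrite [X in _ * X](reindex_onto (@partner L) (@partner L)) => [|v _]; last exact: partnerK.
rewrite [X in _ * X](eq_bigl (fun v : site L => ~~ odd v)); last first.
  by move=> v; rewrite partnerK eqxx odd_partner negbK andbT.
rewrite -big_split; apply: eq_bigr => v ov.
have pvE : partner v = v.+1 :> nat by rewrite partner_val /mate (negbTE ov).
rewrite (@half_turn _ _ _ (partner v, k)); last by apply: nbr_cap => //=; exact: partner_val.
rewrite (@half_turn _ _ (partner v, k) (v, k)); last first.
  by apply: nbr_cap => //=; rewrite partner_val mateK.
rewrite !ffunE /= pvE !quarter.
have -> : (v : nat)%:R - v.+1%:R = -1 :> R by rewrite -[in X in _ - X]addn1 natrD; ring.
have -> : v.+1%:R - (v : nat)%:R = 1 :> R by rewrite -addn1 natrD; ring.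
rewrite /pair_coef /spin; case: (tau (v, k)); case: (tau (partner v, k)); case: e {ke};
  by rewrite /= ?(mulr0, mul0r, mulr1, mul1r, mulrN, mulNr, opprK).
Qed.

(** The four ends at the rung give the two factors [pair_coef]. A straight gluing is counted from
    both sides, which squares an indicator and leaves it unchanged. *)
Lemma rung_half tau (k : 'I_n) (b : bond L) : nat_of_ord b = nth 0%N es k ->
  \prod_v (half tau true (v, widen_ord (leqnSn n) k) * half tau false (v, lift ord0 k)) =
  rung_op lam b (slice tau (lift ord0 k)) (slice tau (widen_ord (leqnSn n) k)).
Proof.
move=> bk; set k0 := widen_ord _ k; set k1 := lift ord0 k.
have k1E : k1 = k.+1 :> nat by [].
have nb := bl_neq_br b.
have e1 : (bl b : nat)%:R - (br b : nat)%:R = -1 :> R by rewrite /= -addn1 natrD; ring.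
have e2 : (br b : nat)%:R - (bl b : nat)%:R = 1 :> R by rewrite /= -addn1 natrD; ring.
rewrite (bigD1 (bl b)) //= (bigD1 (br b)) 1?eq_sym //=.
have bu : bl b = nth 0%N es k :> nat by [].
have bu1 : br b = (nth 0%N es k).+1 :> nat by rewrite -bk.
have es_lt := bonds_lt bs.
rewrite (@half_turn _ true (bl b, k0) (br b, k0)); last first.
  by apply: (@nbr_turn _ _ es_lt _ _ _ (nth 0%N es k)) => //=; left.
rewrite (@half_turn _ true (br b, k0) (bl b, k0)); last first.
  by apply: (@nbr_turn _ _ es_lt _ _ _ (nth 0%N es k)) => //=; right.
rewrite (@half_turn _ false (bl b, k1) (br b, k1)); last first.
  by apply: (@nbr_turn _ _ es_lt _ _ _ (nth 0%N es k)) => //=; left.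
rewrite (@half_turn _ false (br b, k1) (bl b, k1)); last first.
  by apply: (@nbr_turn _ _ es_lt _ _ _ (nth 0%N es k)) => //=; right.
have -> : \prod_(v | (v != bl b) && (v != br b))
    (half tau true (v, k0) * half tau false (v, k1)) =
  (agree_off b (slice tau k1) (slice tau k0))%:R.
  rewrite (eq_bigr (fun v => (slice tau k1 v == slice tau k0 v)%:R)) => [|v /andP[vb vb1]].
    rewrite /agree_off; case: (boolP [forall v, _]) => [/forallP h|].
      by apply: big1 => v vb; have := h v; rewrite vb /= => ->.
    rewrite negb_forall => /existsP[v]; rewrite negb_imply => /andP[vb ne].
    by rewrite (bigD1 v) //= (negbTE ne) mul0r.
  have vu : v <> nth 0%N es k :> nat by rewrite -bu; apply/eqP.
  have vu1 : v <> (nth 0%N es k).+1 :> nat by rewrite -bu1; apply/eqP.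
  rewrite (@half_straight _ true _ (v, k1)); last first.
    by apply: (nbr_up es_lt) => //=; exact: ltn_ord.
  rewrite (@half_straight _ false _ (v, k0)); last first.
    by apply: (nbr_down es_lt).
  by rewrite !ffunE [in X in _ * X]eq_sym; case: eqP => _; rewrite ?mulr1 ?mulr0.
rewrite /rung_op !ffunE !e1 !e2 !quarter /pair_coef /spin.
case: (tau (bl b, k0)); case: (tau (br b, k0)); case: (tau (bl b, k1)); case: (tau (br b, k1));
  rewrite /= ?(mulr0, mul0r, mulr1, mul1r, mulrN, mulNr, opprK) //; ring.
Qed.

(** The ends are regrouped by time instead of by atom: tops of slab [k] with bottoms of slab [k.+1],
    while the lowest bottoms and the highest tops give the two seeds. *)
Lemma transfer_weight (b0 : bond L) tau :
  (consistent tau)%:R * W true lam tau =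
  seed lam (slice tau ord0) *
  (\prod_(k < n) rung_op lam (nth b0 bs k) (slice tau (lift ord0 k))
     (slice tau (widen_ord (leqnSn n) k))) * seed lam (slice tau ord_max).
Proof.
have -> : (consistent tau)%:R * W true lam tau =
    (consistent tau)%:R * \prod_a expR (lam / 4 * turn R tau a).
  by case: (boolP (consistent tau)) => [/W_turn ->//|]; rewrite ?mul0r //; exact: bonds_lt.
rewrite weight_half.
rewrite (eq_bigr (fun a => half tau false (a.1, a.2) * half tau true (a.1, a.2))); last by case.
rewrite -(pair_bigA _ (fun v k => half tau false (v, k) * half tau true (v, k))) exchange_big /=.
rewrite (eq_bigr _ (fun k _ => big_split _ _ _ _ _)) big_split /=.
rewrite big_ord_recl /= [X in _ * X]big_ord_recr /=.
rewrite (@seed_half _ false) // (@seed_half _ true) //.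
rewrite -!mulrA; congr (_ * _); rewrite !mulrA; congr (_ * _).
rewrite mulrC -big_split; apply: eq_bigr => k _ /=.
rewrite -big_split /= (@rung_half _ _ (nth b0 bs k)) //.
by rewrite (nth_map b0) //; have := ltn_ord k; move: (nat_of_ord k) => i; rewrite size_map.
Qed.

(** A pseudo-spin is the path of its slices. The function [f] is attached to the step leaving slab
    [k0], or to the final configuration when [k0] is the last slab, which no step leaves. *)
Lemma transfer_sum (b0 : bond L) (f : conf L -> R) k0 : (k0 <= n)%N ->
  \sum_(tau : pspin L es) (consistent tau)%:R * W true lam tau * f (tau_at tau k0) =
  \sum_s (seed lam s * if n == k0 then f s else 1) *
    evolve (fun k s t => rung_op lam (nth b0 bs k) s t * if k == k0 then f t else 1)
      (seed lam) n s.
Proof.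
move=> k0n; rewrite -path_sum.
pose cut tau : {ffun 'I_n.+1 -> conf L} := finfun (slice tau).
pose paste (p : {ffun 'I_n.+1 -> conf L}) : pspin L es := [ffun a => p a.2 a.1].
rewrite [RHS](reindex_onto cut paste) => [|p _]; last first.
  by apply/ffunP => k; apply/ffunP => v; rewrite !ffunE.
have cE tau k : cut tau k = slice tau k by rewrite ffunE.
apply: eq_big => [tau|tau _].
  by apply/esym/eqP/ffunP => -[v k]; rewrite !ffunE.
rewrite (transfer_weight b0).
rewrite (_ : f (tau_at tau k0) = (\prod_(k < n) if k == k0 :> nat then f (slice tau (widen_ord (leqnSn n) k)) else 1) *
    (if n == k0 then f (slice tau ord_max) else 1)).
  rewrite !cE [X in _ = _ * X * _](eq_bigr (fun k : 'I_n =>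
    rung_op lam (nth b0 bs k) (slice tau (lift ord0 k)) (slice tau (widen_ord (leqnSn n) k)) *
    if k == k0 :> nat then f (slice tau (widen_ord (leqnSn n) k)) else 1)) => [|k _].
    by rewrite [X in _ = _ * X * _]big_split /=; ring.
  by rewrite !cE.
rewrite -(big_ord_recr n (fun k : 'I_n.+1 => if k == k0 :> nat then f (slice tau k) else 1)) /=.
rewrite (bigD1 (inord k0)) //= inordK // eqxx big1 ?mulr1 // => k.
by rewrite -val_eqE /= inordK // => /negbTE ->.
Qed.

End TransferWeight.

(** * From words of bonds to powers of the Hamiltonian *)

Section Amplitudes.
Variables (R : realType) (L : nat) (lam : R).
Implicit Types (A B : op R L) (v : conf L -> R) (f : conf L -> R).

Definition op_app A v : conf L -> R := fun s => \sum_t A s t * v t.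

Lemma op_app_mul A B v s : op_app (op_mul A B) v s = op_app A (op_app B v) s.
Proof.
rewrite /op_app /op_mul; under eq_bigr do rewrite mulr_suml.
rewrite exchange_big; apply: eq_bigr => t _ /=.
by rewrite mulr_sumr; apply: eq_bigr => r _; rewrite mulrA.
Qed.

Lemma op_app_id v s : op_app (@op_id R L) v s = v s.
Proof.
rewrite /op_app /op_id (bigD1 s) //= eqxx mul1r big1 ?addr0 // => t /negbTE.
by rewrite eq_sym => ->; rewrite mul0r.
Qed.

Lemma op_app_diag f v s : op_app (op_diag f) v s = f s * v s.
Proof.
rewrite /op_app /op_diag (bigD1 s) //= eqxx mul1r big1 ?addr0 // => t /negbTE.
by rewrite eq_sym => ->; rewrite !mul0r.
Qed.

Lemma braket_app A : braket lam A = \sum_s seed lam s * op_app A (seed lam) s.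
Proof.
apply: eq_bigr => s _; rewrite /op_app mulr_sumr.
by apply: eq_bigr => t _; rewrite mulrA.
Qed.

(** The first [k0] steps do not involve [f]; it enters once, at slab [k0], and the later steps are
    again plain applications of [A]. *)
Lemma evolve_insert A f v k0 j s :
  evolve (fun k s t => A s t * if k == k0 then f t else 1) v (k0 + j) s *
    (if j == 0%N then f s else 1) =
  op_app (op_mul (op_pow A j) (op_mul (op_diag f) (op_pow A k0))) v s.
Proof.
have before m r : (m <= k0)%N ->
    evolve (fun k s t => A s t * if k == k0 then f t else 1) v m r = op_app (op_pow A m) v r.
  elim: m r => [|m IH] r mk; first by rewrite op_app_id.
  rewrite [RHS]op_app_mul /=; apply: eq_bigr => t _.
  by rewrite IH 1?ltnW // ifF ?mulr1 //; apply/negbTE; rewrite neq_ltn mk.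
elim: j s => [|j IH] s.
  by rewrite addn0 before //= op_app_mul op_app_id op_app_mul op_app_diag mulrC.
rewrite mulr1 addnS op_app_mul [LHS]/= (op_app_mul A (op_pow A j)).
apply: eq_bigr => t _; rewrite -mulrA; congr (_ * _).
rewrite -op_app_mul -IH mulrC; congr (_ * _).
by rewrite -[X in _ == X]addn0 eqn_add2l.
Qed.

(** Summing every letter independently over the bonds turns the kernel of each step into minus the
    Hamiltonian. *)
Lemma word_sum f n k : (0 < L)%N -> ~~ odd L -> (k <= n)%N ->
  \sum_(bs : n.-tuple (bond L)) \sum_(tau : pspin L [seq nat_of_ord b | b <- bs])
     (consistent tau)%:R * W true lam tau * f (tau_at tau k) =
  let M : op R L := fun s s' => - H_XXZ_pm true lam s s' in
  braket lam (op_mul (op_pow M (n - k)) (op_mul (op_diag f) (op_pow M k))).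
Proof.
move=> L0 evL kn /=.
have b0 : bond L by apply: (@Ordinal _ 0%N); rewrite -ltnS prednK ?double_gt0 //; case: L L0.
rewrite braket_app (eq_bigr (fun bs : n.-tuple (bond L) =>
  \sum_s (seed lam s * if n == k then f s else 1) *
    evolve (fun m s t => rung_op lam (nth b0 bs m) s t * if m == k then f t else 1)
      (seed lam) n s)); last first.
  by move=> bs _; rewrite (transfer_sum _ b0) size_map size_tuple.
rewrite (evolve_sum b0 (fun b m s t => rung_op lam b s t * if m == k then f t else 1)).
apply: eq_bigr => s _; rewrite -mulrA; congr (_ * _).
rewrite -evolve_insert subnKC // mulrC; congr (_ * _); last first.
  by rewrite -[in RHS](eqn_add2l k) subnKC // addn0.
congr (evolve _ _ _ _); apply/funext => m; apply/funext => r; apply/funext => t.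
by rewrite -mulr_suml H_XXZ_rung_op.
Qed.

End Amplitudes.

(** * Iterated integrals over rung times *)

Section IteratedIntegral.
Variables (R : realType) (beta : R).
Hypothesis beta_gt0 : 0 < beta.
Local Open Scope classical_set_scope.
Local Notation mu := (@lebesgue_measure R).
Local Notation I := (`](- (beta / 2)), (beta / 2)[%classic : set R).

Lemma interval_measure : mu I = beta%:E.
Proof.
have b0 : 0 < beta / 2 by rewrite divr_gt0.
have b2 : - (beta / 2) < beta / 2 by rewrite (lt_trans _ b0) // oppr_lt0.
rewrite lebesgue_measure_itv /= lte_fin b2.
by rewrite -EFinB opprK -splitr.
Qed.

(* Joint measurability of [G] in the parameter and the remaining integration
   variables, with the variables moved into the parameter space one at a time. *)
Fixpoint jointly_measurable n d (Z : measurableType d) (G : Z -> seq R -> R) : Prop :=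
  if n is n'.+1 then @jointly_measurable n' _ (Z * R)%type (fun z ts => G z.1 (z.2 :: ts))
  else measurable_fun setT (fun z => G z [::]).

Lemma jointly_measurableD n d (Z : measurableType d) (F G : Z -> seq R -> R) :
  jointly_measurable n F -> jointly_measurable n G ->
  jointly_measurable n (fun z ts => F z ts + G z ts).
Proof.
elim: n d Z F G => [|n IH] d Z F G /=; first exact: measurable_funD.
exact: IH.
Qed.

Lemma jointly_measurable0 n d (Z : measurableType d) :
  jointly_measurable n (fun (_ : Z) _ => 0 : R).
Proof. by elim: n d Z => [|n IH] d Z /=; [exact: measurable_cst|exact: IH]. Qed.

Lemma integrable_bounded (g : R -> R) (C : R) : measurable_fun setT g ->
  (forall x, `|g x| <= C) -> mu.-integrable I (EFin \o g).
Proof.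
move=> mg gC; apply: measurable_bounded_integrable => //=.
- by rewrite interval_measure ltry.
- exact: measurable_funTS.
- by exists C; split; [exact: num_real|move=> M CM x _; exact: le_trans (gC x) (ltW CM)].
Qed.

Lemma Rintegral_bound (g : R -> R) (C : R) : measurable_fun setT g ->
  (forall x, `|g x| <= C) -> `|Rintegral mu I g| <= C * beta.
Proof.
move=> mg gC; have ig := integrable_bounded mg gC.
apply: le_trans (le_normr_Rintegral _ ig) _ => //.
have -> : C * beta = Rintegral mu I (fun=> C).
  by rewrite Rintegral_cst //= interval_measure.
apply: le_Rintegral => //.
- exact: integrable_norm.
- by apply: (integrable_bounded (C := `|C|)) => // x; exact: measurable_cst.
Qed.

(** Adding [C] makes the integrand nonnegative, so that Tonelli gives measurability; the excess
    [C * beta] is then subtracted. *)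
Lemma measurable_Rintegral d (Z : measurableType d) (g : Z * R -> R) (C : R) :
  measurable_fun setT g -> (forall z, `|g z| <= C) ->
  measurable_fun setT (fun z => Rintegral mu I (fun x => g (z, x))).
Proof.
move=> mg gC; pose h (zx : Z * R) : R := (g zx + C) * \1_I zx.2.
have mh : measurable_fun setT h.
  apply: measurable_funM; first by apply: measurable_funD => //; exact: measurable_cst.
  by apply: measurableT_comp => //; exact: measurable_indic.
have h0 zx : (0 <= (h zx)%:E)%E.
  rewrite lee_fin mulr_ge0 // ?indicE ?ler0n //.
  by rewrite -lerBlDr sub0r; have := gC zx; rewrite ler_norml => /andP[].
have -> : (fun z => Rintegral mu I (fun x => g (z, x))) =
    (fun z => fine (fubini_F mu (EFin \o h) z) - C * beta).
  apply/funext => z; rewrite /fubini_F.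
  have mgz : measurable_fun setT (fun x => g (z, x)) by exact: measurable_fun_pair2.
  have -> : fine (\int[mu]_y (EFin \o h) (z, y)) = Rintegral mu I (fun x => g (z, x) + C).
    rewrite /Rintegral [in RHS]integral_mkcond; congr fine.
    apply: eq_integral => y _; rewrite /h /= patchE indicE.
    by case: (y \in _); rewrite ?mulr1 ?mulr0.
  rewrite RintegralD //; last 2 first.
  - exact: integrable_bounded (fun x => gC (z, x)).
  - by apply: (integrable_bounded (C := `|C|)) => //; exact: measurable_cst.
  by rewrite Rintegral_cst //= interval_measure /= addrK.
apply: measurable_funB; last exact: measurable_cst.
apply: measurableT_comp; first exact: fine_measurable.
apply: measurable_fun_fubini_tonelli_F => //.
exact/measurable_EFinP.
Qed.

(** Both conclusions are proved in one induction, because measurability of the outer integral uses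
    the bound on the inner one. *)
Lemma iint_measurable n d (Z : measurableType d) (G : Z -> seq R -> R) (C : R) :
  jointly_measurable n G -> (forall z ts, size ts = n -> `|G z ts| <= C) ->
  measurable_fun setT (fun z => iint beta n (G z)) /\
  forall z, `|iint beta n (G z)| <= C * beta ^+ n.
Proof.
elim: n d Z G => [|n IH] d Z G /= mG GC.
  by split=> // z; rewrite expr0 mulr1; exact: GC.
have [|mi bi] := IH _ _ _ mG; first by move=> z ts tn; apply: GC; rewrite /= tn.
split; first exact: measurable_Rintegral mi bi.
move=> z; rewrite exprSr mulrA; apply: Rintegral_bound => [|x].
  exact: (measurable_fun_pair2 z mi).
exact: (bi (z, x)).
Qed.

Lemma iintD n d (Z : measurableType d) (F G : Z -> seq R -> R) (C : R) :
  jointly_measurable n F -> jointly_measurable n G ->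
  (forall z ts, size ts = n -> `|F z ts| <= C) ->
  (forall z ts, size ts = n -> `|G z ts| <= C) ->
  forall z, iint beta n (fun ts => F z ts + G z ts) = iint beta n (F z) + iint beta n (G z).
Proof.
elim: n d Z F G => [//|n IH] d Z F G /= mF mG FC GC z.
have FC' (z' : Z * R) ts : size ts = n -> `|F z'.1 (z'.2 :: ts)| <= C.
  by move=> tn; apply: FC; rewrite /= tn.
have GC' (z' : Z * R) ts : size ts = n -> `|G z'.1 (z'.2 :: ts)| <= C.
  by move=> tn; apply: GC; rewrite /= tn.
have [miF biF] := iint_measurable mF FC'; have [miG biG] := iint_measurable mG GC'.
rewrite -RintegralD //.
- by apply: eq_Rintegral => x _; exact: (IH _ _ _ _ mF mG FC' GC' (z, x)).
- exact: (integrable_bounded (measurable_fun_pair2 z miF) (fun x => biF (z, x))).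
- exact: (integrable_bounded (measurable_fun_pair2 z miG) (fun x => biG (z, x))).
Qed.

Lemma eq_iint n (F G : seq R -> R) : (forall ts, size ts = n -> F ts = G ts) ->
  iint beta n F = iint beta n G.
Proof.
elim: n F G => [|n IH] F G FG /=; first exact: FG.
by apply: eq_Rintegral => x _; apply: IH => ts tn; apply: FG; rewrite /= tn.
Qed.

Lemma iint0 n : iint beta n (fun _ => 0 : R) = 0.
Proof.
by elim: n => //= n IH; rewrite IH Rintegral_cst // mul0r.
Qed.

Lemma iint_sum n d (Z : measurableType d) (J : Type) (s : seq J)
    (G : J -> Z -> seq R -> R) (C : J -> R) z :
  (forall j, jointly_measurable n (G j)) ->
  (forall j z ts, size ts = n -> `|G j z ts| <= C j) ->
  iint beta n (fun ts => \sum_(j <- s) G j z ts) = \sum_(j <- s) iint beta n (G j z).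
Proof.
move=> mG GC; elim: s => [|j s IH].
  by rewrite big_nil -[RHS](iint0 n); apply: eq_iint => ts _; rewrite big_nil.
rewrite big_cons -IH.
have ms : jointly_measurable n (fun z ts => \sum_(j <- s) G j z ts).
  elim: s {IH} => [|k s IH].
    rewrite (_ : (fun _ => _) = (fun _ _ => 0)); first exact: jointly_measurable0.
    by apply/funext => ?; apply/funext => ?; rewrite big_nil.
  rewrite (_ : (fun _ => _) = (fun z ts => G k z ts + \sum_(j <- s) G j z ts)).
    exact: jointly_measurableD.
  by apply/funext => ?; apply/funext => ?; rewrite big_cons.
have sC z' ts : size ts = n -> `|\sum_(j <- s) G j z' ts| <= \sum_(j <- s) C j.
  by move=> tn; apply: le_trans (ler_norm_sum _ _ _) _; apply: ler_sum => k _; exact: GC.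
rewrite -(iintD (C := Num.max (C j) (\sum_(j <- s) C j)) (mG j) ms).
- by apply: eq_iint => ts _; rewrite big_cons.
- by move=> z' ts tn; rewrite le_max GC.
- by move=> z' ts tn; rewrite le_max sC // orbT.
Qed.

(** All that the integrand sees of the times. There are finitely many types, each cut out by
    comparisons, and ties are recorded too, so no null set has to be discarded. *)
Definition order_type n (xs : seq R) : {ffun 'I_n * 'I_n -> bool} * {ffun 'I_n -> bool} :=
  ([ffun ij : 'I_n * 'I_n => xs`_ij.1 <= xs`_ij.2], [ffun i : 'I_n => xs`_i < 0]).

Definition order_invariant n (H : seq R -> R) := forall xs ys,
  size xs = n -> size ys = n -> order_type n xs = order_type n ys -> H xs = H ys.

Lemma measurable_from_bool d (Z : measurableType d) (b : Z -> bool) (h : bool -> R) :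
  measurable_fun setT b -> measurable_fun setT (fun z => h (b z)).
Proof. by move=> mb; apply: (measurableT_comp _ mb). Qed.

Lemma measurable_order_invariant d (Z : measurableType d) (cs : seq (Z -> R)) H :
  order_invariant (size cs) H -> (forall i, measurable_fun setT (nth (fun=> 0) cs i)) ->
  measurable_fun setT (fun z => H [seq c z | c <- cs]).
Proof.
set n := size cs => HH mc.
pose X z := [seq c z | c <- cs].
have Xn z : size (X z) = n by rewrite size_map.
(* The value on a type is read off a representative; types that do not occur get [0]. *)
pose h p := if pselect (exists xs, size xs = n /\ order_type n xs = p) is left e
  then H (projT1 (cid e)) else 0.
have hE z : H (X z) = h (order_type n (X z)).
  rewrite /h; case: pselect => [e|[]]; last by exists (X z).
  by case: cid => xs /= [xn xz]; exact: HH.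
have nthX z (i : 'I_n) : (X z)`_i = nth (fun=> 0) cs i z.
  by rewrite (nth_map (fun=> 0)).
pose ind (p : {ffun 'I_n * 'I_n -> bool} * {ffun 'I_n -> bool}) z : R := (\prod_(ij : 'I_n * 'I_n)
    (((nth (fun=> 0) cs ij.1 z <= nth (fun=> 0) cs ij.2 z) == p.1 ij)%:R)) *
  \prod_(i < n) (((nth (fun=> 0) cs i z < 0) == p.2 i)%:R).
have indE p z : (order_type n (X z) == p)%:R = ind p z.
  rewrite /ind; case: eqP => [<-|np].
    by rewrite !big1 ?mulr1 // => i _; rewrite ffunE !nthX eqxx.
  apply/esym/eqP; rewrite mulf_eq0; apply: contra_notT np.
  rewrite negb_or => /andP[n1 n2]; case: p n1 n2 => p1 p2 /= n1 n2; congr (_, _); apply/ffunP => i.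
    rewrite ffunE; move: n1 => /prodf_neq0/(_ i isT).
    by rewrite /= !nthX; case: (_ <= _); case: (p1 i); rewrite /= ?mulr0n ?eqxx.
  rewrite ffunE; move: n2 => /prodf_neq0/(_ i isT).
  by rewrite /= !nthX; case: (_ < _); case: (p2 i); rewrite /= ?mulr0n ?eqxx.
rewrite (_ : (fun _ => _) = (fun z => \sum_p h p * ind p z)).
  apply: measurable_sum => p; apply: measurable_funM; first exact: measurable_cst.
  apply: measurable_funM; apply: measurable_prod => i _.
    apply: (measurable_from_bool (fun b => (b == p.1 i)%:R)).
    exact: measurable_fun_ler.
  apply: (measurable_from_bool (fun b => (b == p.2 i)%:R)).
  by apply: measurable_fun_ltr => //; exact: measurable_cst.
apply/funext => z; rewrite (bigD1 (order_type n (X z))) //= -indE eqxx mulr1 big1 ?addr0 ?hE //.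
by move=> p /negbTE ne; rewrite -indE eq_sym ne mulr0.
Qed.

(** The list [cs] holds the times already turned into parameters as coordinate functions; each step
    appends the new coordinate [snd]. *)
Lemma jointly_measurable_order_invariant m d (Z : measurableType d) (cs : seq (Z -> R)) H :
  order_invariant (size cs + m) H -> (forall i, measurable_fun setT (nth (fun=> 0) cs i)) ->
  jointly_measurable m (fun z ts => H ([seq c z | c <- cs] ++ ts)).
Proof.
elim: m d Z cs => [|m IH] d Z cs HH mc /=.
  under eq_fun do rewrite cats0.
  by apply: measurable_order_invariant => //; rewrite -[size cs]addn0.
pose cs' : seq (Z * R -> R) := rcons [seq c \o fst | c <- cs] snd.
rewrite (_ : (fun _ => _) = (fun (z : Z * R) ts => H ([seq c z | c <- cs'] ++ ts))).
  apply: IH; first by rewrite size_rcons size_map addSnnS.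
  move=> i; rewrite /cs' nth_rcons size_map; case: ltnP => ic.
    by rewrite (nth_map (fun=> 0)) //; exact: measurableT_comp.
  by case: eqP => _; [exact: measurable_snd|exact: measurable_cst].
apply/funext => z; apply/funext => ts; rewrite /cs' map_rcons cat_rcons -map_comp.
by [].
Qed.

End IteratedIntegral.

(** * Dependence on the times through their order *)

Section TimeOrder.
Variables (R : realType) (L n : nat).
Implicit Types (bs : n.-tuple (bond L)) (ts : seq R).

Definition time_order ts : seq 'I_n := sort (fun i j : 'I_n => ts`_i <= ts`_j) (enum 'I_n).

Lemma bond_list_zip bs ts : size ts = n ->
  bond_list (zip bs ts) = [seq nat_of_ord (tnth bs i) | i <- time_order ts].
Proof.
move=> tn; have -> : zip bs ts = [seq (tnth bs i, ts`_i) | i <- enum 'I_n].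
  have [t tE] : exists t : n.-tuple R, ts = t by exists (tcast tn (in_tuple ts)); rewrite val_tcast.
  rewrite tE {ts tn tE}; rewrite -[in LHS](map_tnth_enum bs) -[in LHS](map_tnth_enum t) zip_map.
  by apply: eq_map => i; rewrite /= (tnth_nth 0 t).
by rewrite /bond_list /sort_rungs sort_map -map_comp.
Qed.

Lemma count_neg_enum ts : size ts = n ->
  count (fun t => t < 0) ts = count (fun i : 'I_n => ts`_i < 0) (enum 'I_n).
Proof.
move=> tn; rewrite -[in LHS](mkseq_nth 0 ts) /mkseq tn -val_enum_ord -map_comp count_map.
exact: eq_count.
Qed.

Lemma slab0_zip bs ts : size ts = n -> slab0 (zip bs ts) = count (fun t => t < 0) ts.
Proof.
move=> tn; rewrite /slab0 -[in RHS](@unzip2_zip _ _ bs ts) ?size_tuple ?tn //.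
by rewrite count_map.
Qed.

Lemma order_type_time_order (xs ys : seq R) :
  order_type n xs = order_type n ys -> time_order xs = time_order ys.
Proof.
case=> /ffunP e _; congr (sort _ _); apply/funext => i; apply/funext => j.
by have := e (i, j); rewrite !ffunE.
Qed.

Lemma order_type_neg (xs ys : seq R) : size xs = n -> size ys = n ->
  order_type n xs = order_type n ys -> count (fun t => t < 0) xs = count (fun t => t < 0) ys.
Proof.
move=> xn yn [_ /ffunP e]; rewrite !count_neg_enum //; apply: eq_count => i.
by have := e i; rewrite !ffunE.
Qed.

(** For fixed times, sorting acts on words as a fixed permutation of positions, a bijection of the
    set of words. *)
Lemma sum_time_order (K : seq nat -> R) ts :
  \sum_(bs : n.-tuple (bond L)) K [seq nat_of_ord (tnth bs i) | i <- time_order ts] =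
  \sum_(bs : n.-tuple (bond L)) K [seq nat_of_ord b | b <- bs].
Proof.
have sz : size (time_order ts) == n by rewrite size_sort size_enum_ord.
pose p : n.-tuple 'I_n := Tuple sz.
have pI : injective (tnth p).
  by apply/tuple_uniqP; rewrite /= sort_uniq enum_uniq.
have [q pq qp] := injF_bij pI.
rewrite [RHS](reindex (fun bs : n.-tuple (bond L) => [tuple tnth bs (tnth p i) | i < n])).
  apply: eq_bigr => bs _; congr K; rewrite -[time_order ts]/(tval p) -[in LHS](map_tnth_enum p).
  by rewrite /= -!map_comp.
exists (fun bs : n.-tuple (bond L) => [tuple tnth bs (q i) | i < n]) => bs _;
  by apply: eq_from_tnth => i; rewrite !tnth_mktuple ?pq ?qp.
Qed.

Lemma order_invariant_bounded (H : seq R -> R) : order_invariant n H ->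
  exists C, forall ts, size ts = n -> `|H ts| <= C.
Proof.
move=> HH; pose h p := if pselect (exists xs, size xs = n /\ order_type n xs = p) is left e
  then H (projT1 (cid e)) else 0.
exists (\sum_p `|h p|) => ts tn; have -> : H ts = h (order_type n ts).
  rewrite /h; case: pselect => [e|[]]; last by exists ts.
  by case: cid => xs /= [xn xz]; exact: HH.
by rewrite (bigD1 (order_type n ts)) //= lerDl sumr_ge0.
Qed.

End TimeOrder.

(** * Integration over the rung times *)

Section WordIntegral.
Variables (R : realType) (beta : R).
Hypothesis beta_gt0 : 0 < beta.
Local Notation mu := (@lebesgue_measure R).

Lemma Rintegral_neg (g : bool -> R) :
  Rintegral mu `](- (beta / 2)), (beta / 2)[%classic (fun x => g (x < 0)) =
  beta / 2 * (g true + g false).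
Proof.
have b0 : 0 < beta / 2 by rewrite divr_gt0.
have mg : measurable_fun setT (fun x : R => g (x < 0)).
  by apply: measurable_from_bool; apply: measurable_fun_ltr => //; exact: measurable_cst.
have gC (x : R) : `|g (x < 0)| <= `|g true| + `|g false|.
  by case: (x < 0); rewrite ?lerDl ?lerDr.
have UE : `](- (beta / 2)), (beta / 2)[%classic =
    (`](- (beta / 2)), 0[%classic `|` `[0, (beta / 2)[%classic)%classic :> set R.
  apply/seteqP; split=> x /=; rewrite !in_itv /=.
    by move=> /andP[-> ->]; have [x0|x0] := ltP x 0; [left|right].
  by case=> /andP[xa xb]; apply/andP; split=> //; [exact: lt_trans xb b0|rewrite (lt_le_trans _ xa) // oppr_lt0].
rewrite UE Rintegral_setU //=; last 2 first.
- by rewrite -UE; exact: (integrable_bounded beta_gt0 mg gC).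
- apply/disj_setPS => x /= []; rewrite !in_itv /= => /andP[_ x0] /andP[x1 _].
  by move: (lt_le_trans x0 x1); rewrite ltxx.
rewrite (@eq_Rintegral _ _ _ _ _ (fun=> g true)); last first.
  by move=> x; rewrite inE /= in_itv /= => /andP[_ ->].
rewrite [X in _ + X](@eq_Rintegral _ _ _ _ _ (fun=> g false)); last first.
  by move=> x; rewrite inE /= in_itv /= => /andP[x0 _]; rewrite ltNge x0.
rewrite !Rintegral_cst //= !lebesgue_measure_itv /= !lte_fin oppr_lt0 b0 /=.
by rewrite !opprK; ring.
Qed.

(** Each time is negative on one half of the interval, of length [beta / 2]; the induction step is
    Pascal's rule. *)
Lemma iint_count n (g : nat -> R) :
  iint beta n (fun ts => g (count (fun t => t < 0) ts)) =
  (beta / 2) ^+ n * \sum_(k < n.+1) 'C(n, k)%:R * g k.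
Proof.
elim: n g => [|n IH] g /=; first by rewrite big_ord1 bin0 !mul1r.
pose A (b : bool) := (beta / 2) ^+ n * \sum_(k < n.+1) 'C(n, k)%:R * g (b + k)%N.
transitivity (Rintegral mu `](- (beta / 2)), (beta / 2)[%classic (fun x : R => A (x < 0))).
  by apply: eq_Rintegral => x _; exact: (IH (fun k => g ((x < 0)%R + k)%N)).
rewrite Rintegral_neg /A -mulrDr exprS mulrA; congr (_ * _).
rewrite [in RHS]big_ord_recl /= bin0.
rewrite [X in _ = _ + X](eq_bigr (fun k : 'I_n.+1 => 'C(n, k.+1)%:R * g k.+1 + 'C(n, k)%:R * g k.+1)); last first.
  by move=> k _; rewrite /bump /= add1n binS natrD mulrDl.
rewrite big_split /= addrA [RHS]addrC; congr (_ + _).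
rewrite big_ord_recl [in RHS]big_ord_recr /= bin0 bin_small // mul0r addr0; congr (_ + _).
Qed.

(** The sum over words is moved inside the integral first, since the order of the times disappears
    only after that sum; what remains depends on the number of negative times. *)
Lemma word_integral L n (K : seq nat -> nat -> R) :
  \sum_(bs : n.-tuple (bond L)) iint beta n (fun ts => K (bond_list (zip bs ts)) (slab0 (zip bs ts))) =
  (beta / 2) ^+ n * \sum_(k < n.+1) 'C(n, k)%:R *
    \sum_(bs : n.-tuple (bond L)) K [seq nat_of_ord b | b <- bs] k.
Proof.
pose G (bs : n.-tuple (bond L)) (ts : seq R) := K (bond_list (zip bs ts)) (slab0 (zip bs ts)).
have Ginv bs : order_invariant n (G bs).
  move=> xs ys xn yn e; rewrite /G !bond_list_zip // !slab0_zip //.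
  by rewrite (order_type_time_order e) (order_type_neg xn yn e).
have /choice[C GC] bs := order_invariant_bounded (Ginv bs).
rewrite -(iint_count n (fun k => \sum_(bs : n.-tuple (bond L)) K [seq nat_of_ord b | b <- bs] k)).
rewrite -(@iint_sum _ _ beta_gt0 n _ unit _ _ (fun bs _ => G bs) C tt).
- apply: eq_iint => ts tn; rewrite -(@sum_time_order R L n (K ^~ (count (fun t => t < 0) ts)) ts).
  by apply: eq_bigr => bs _; rewrite /G bond_list_zip // slab0_zip.
- move=> bs; apply: (@jointly_measurable_order_invariant _ n _ unit [::] (G bs)).
    exact: Ginv.
  by move=> i; rewrite nth_nil; exact: measurable_cst.
- by move=> bs _; exact: GC.
Qed.

End WordIntegral.

(** * Exponential series *)

Section CauchyProduct.
Variable R : realType.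
Implicit Types (F : nat -> nat -> R).

(** Both sides run over the pairs with [j + k < N], grouped on the left by the value of [j + k]. *)
Lemma sum_triangle F N :
  \sum_(n < N) \sum_(k < n.+1) F (n - k)%N k =
  \sum_(j < N) \sum_(k < N | (j + k < N)%N) F j k.
Proof.
transitivity (\sum_(n < N) \sum_(k < N) \sum_(j < N | (j + k == n)%N) F j k).
  apply: eq_bigr => n _; rewrite (big_ord_widen N (fun k => F (n - k)%N k)) ?ltn_ord //.
  rewrite big_mkcond; apply: eq_bigr => k _; rewrite ltnS; case: leqP => kn.
    rewrite (big_pred1 (Ordinal (leq_ltn_trans (leq_subr k n) (ltn_ord n)))) //= => j.
    by apply/eqP/eqP => [h|->] /=; [apply: val_inj => /=|]; lia.
  by rewrite big_pred0 // => j; apply/negbTE; apply/eqP; lia.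
rewrite exchange_big [RHS](exchange_big_dep predT) //=; apply: eq_bigr => k _.
rewrite (exchange_big_dep predT) //= [RHS]big_mkcond; apply: eq_bigr => j _.
case: ltnP => jk; first by rewrite (big_pred1 (Ordinal jk)) // => n; apply/eqP/eqP => [h|->] //; exact: val_inj.
by rewrite big_pred0 // => n; apply/negbTE; apply/eqP; have := ltn_ord n; lia.
Qed.

Lemma sum_square_triangle F N :
  \sum_(j < N) \sum_(k < N) F j k - \sum_(n < N) \sum_(k < n.+1) F (n - k)%N k =
  \sum_(j < N) \sum_(k < N | ~~ (j + k < N)%N) F j k.
Proof.
rewrite sum_triangle -sumrB; apply: eq_bigr => j _.
by rewrite [X in X - _](bigID (fun k : 'I_N => (j + k < N)%N)) /= [LHS]addrC addKr.
Qed.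

Lemma fact_bin (x : R) n k : (k <= n)%N ->
  x ^+ n / n`!%:R * 'C(n, k)%:R = x ^+ (n - k) / (n - k)`!%:R * (x ^+ k / k`!%:R).
Proof.
move=> kn; have /(congr1 (fun m => m%:R : R)) := bin_fact kn; rewrite !natrM => <-.
rewrite -{1}(subnK kn) exprD.
have f0 m : m`!%:R != 0 :> R by rewrite pnatr_eq0 -lt0n fact_gt0.
have c0 : 'C(n, k)%:R != 0 :> R by rewrite pnatr_eq0 -lt0n bin_gt0.
by field; rewrite !f0 c0.
Qed.

Local Open Scope classical_set_scope.

Lemma expR_cvg (y : R) : (fun N => \sum_(k < N) y ^+ k / k`!%:R) @ \oo --> expR y.
Proof.
have -> : (fun N => \sum_(k < N) y ^+ k / k`!%:R) = series (exp_coeff y).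
  by apply/funext => N; rewrite /series /= big_mkord.
exact: is_cvg_series_exp_coeff.
Qed.

(* The defect between square and triangular partial sums is dominated by the one
   for the exponential series, where both tend to [exp y * exp y = exp (y + y)]. *)
Lemma cauchy_exp (x C A l : R) F : 0 <= x -> 0 <= C -> 
  (forall j k, `|F j k| <= A * (C ^+ j * C ^+ k)) ->
  (fun N => \sum_(j < N) \sum_(k < N) x ^+ j / j`!%:R * (x ^+ k / k`!%:R) * F j k) @ \oo --> l ->
  (fun N => \sum_(n < N) x ^+ n / n`!%:R * \sum_(k < n.+1) 'C(n, k)%:R * F (n - k)%N k) @ \oo --> l.
Proof.
move=> x0 C0 FA Sl; pose y := x * C.
have y0 : 0 <= y by rewrite mulr_ge0.
pose G j k : R := x ^+ j / j`!%:R * (x ^+ k / k`!%:R) * F j k.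
pose E j k : R := y ^+ j / j`!%:R * (y ^+ k / k`!%:R).
have GE j k : `|G j k| <= A * E j k.
  rewrite /G /E normrM ger0_norm ?mulr_ge0 ?divr_ge0 ?exprn_ge0 ?ler0n //.
  have -> : A * (y ^+ j / j`!%:R * (y ^+ k / k`!%:R)) =
      x ^+ j / j`!%:R * (x ^+ k / k`!%:R) * (A * (C ^+ j * C ^+ k)).
    by rewrite /y !exprMn; ring.
  by rewrite ler_wpM2l // ?mulr_ge0 ?divr_ge0 ?exprn_ge0 ?ler0n.
have triE (z : R) (H : nat -> nat -> R) N :
    \sum_(n < N) z ^+ n / n`!%:R * (\sum_(k < n.+1) 'C(n, k)%:R * H (n - k)%N k) =
    \sum_(n < N) \sum_(k < n.+1) z ^+ (n - k) / (n - k)`!%:R * (z ^+ k / k`!%:R) * H (n - k)%N k.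
  apply: eq_bigr => n _; rewrite mulr_sumr; apply: eq_bigr => k _.
  by rewrite mulrA fact_bin // -ltnS.
pose D N := \sum_(j < N) \sum_(k < N) G j k - \sum_(n < N) \sum_(k < n.+1) G (n - k)%N k.
pose DE N := \sum_(j < N) \sum_(k < N) E j k - \sum_(n < N) \sum_(k < n.+1) E (n - k)%N k.
have DDE N : `|D N| <= A * DE N.
  rewrite /D /DE !sum_square_triangle mulr_sumr; apply: le_trans (ler_norm_sum _ _ _) _.
  apply: ler_sum => j _; rewrite mulr_sumr; apply: le_trans (ler_norm_sum _ _ _) _.
  by apply: ler_sum => k _.
have DE0 : DE N @[N --> \oo] --> (0 : R).
  have -> : DE = (fun N => (\sum_(k < N) y ^+ k / k`!%:R) * (\sum_(k < N) y ^+ k / k`!%:R)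
      - \sum_(n < N) (y + y) ^+ n / n`!%:R).
    apply/funext => N; rewrite /DE; congr (_ - _).
      by rewrite mulr_suml; apply: eq_bigr => j _; rewrite mulr_sumr.
    have := triE y (fun _ _ => 1) N.
    rewrite [X in _ = X -> _](eq_bigr (fun n : 'I_N => \sum_(k < n.+1) E (n - k)%N k)) => [<-|n _]; last first.
      by apply: eq_bigr => k _; rewrite mulr1.
    apply: eq_bigr => n _; rewrite exprDn mulrC mulr_suml mulr_suml.
    apply: eq_bigr => k _; rewrite mulr1 -exprD subnK -1?ltnS // -mulr_natr; ring.
  rewrite -[X in _ --> X](subrr (expR (y + y))) {1}expRD.
  by apply: cvgB; [apply: cvgM|]; exact: expR_cvg.
have D0 : D N @[N --> \oo] --> (0 : R).
  apply/norm_cvg0P; apply: (@squeeze_cvgr _ _ _ _ (fun=> 0) (fun N => A * DE N)).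
  - by apply: nearW => N; rewrite normr_ge0 DDE.
  - exact: cvg_cst.
  - by rewrite -[X in _ --> X](mulr0 A); apply: cvgM => //; exact: cvg_cst.
have -> : (fun N => \sum_(n < N) x ^+ n / n`!%:R * \sum_(k < n.+1) 'C(n, k)%:R * F (n - k)%N k) =
    (fun N => \sum_(j < N) \sum_(k < N) G j k - D N).
  by apply/funext => N; rewrite triE /D opprB addrC subrK.
by rewrite -[X in _ --> X]subr0; exact: cvgB.
Qed.

Lemma cvg_exp_series (x C A : R) (a : nat -> R) : 0 <= x ->
  (forall k, `|a k| <= A * C ^+ k) ->
  cvgn (fun N => \sum_(k < N) x ^+ k / k`!%:R * a k).
Proof.
move=> x0 aA; have -> : (fun N => \sum_(k < N) x ^+ k / k`!%:R * a k) =
    series (fun k => x ^+ k / k`!%:R * a k).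
  by apply/funext => N; rewrite /series /= big_mkord.
apply: normed_cvg.
have h k : `|x ^+ k / k`!%:R * a k| <= A * exp_coeff (x * C) k.
  rewrite /exp_coeff /= normrM ger0_norm ?divr_ge0 ?exprn_ge0 ?ler0n //.
  have -> : A * ((x * C) ^+ k / k`!%:R) = x ^+ k / k`!%:R * (A * C ^+ k).
    by rewrite exprMn; ring.
  by rewrite ler_wpM2l // divr_ge0 ?exprn_ge0 ?ler0n.
apply: (series_le_cvg _ _ h) => [k|k|] //=; first exact: le_trans (h k).
exact: (@is_cvg_seriesZ _ _ A (is_cvg_series_exp_coeff (x * C))).
Qed.

End CauchyProduct.

(** * Convergence of matrix exponentials and amplitudes *)

Section OperatorExp.
Variables (R : realType) (L : nat).
Implicit Types (A B : op R L) (v : conf L -> R).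
Local Open Scope classical_set_scope.

Lemma eq_cvgn (u u' : nat -> R) (l : R) : u =1 u' -> u @ \oo --> l -> u' @ \oo --> l.
Proof. by move=> /funext ->. Qed.

(** A crude norm: it dominates every row sum, so its powers bound the entries of [op_pow]. *)
Definition op_size A := \sum_s \sum_t `|A s t|.

Lemma op_pow_bound A k s t : `|op_pow A k s t| <= op_size A ^+ k.
Proof.
have row r : \sum_t `|A r t| <= op_size A.
  rewrite /op_size [leRHS](bigD1 r) //= lerDl.
  by apply: sumr_ge0 => *; exact: sumr_ge0.
elim: k s => [|k IH] s /=.
  by rewrite /op_id; case: (s == t); rewrite ?normr1 ?normr0 // expr0.
rewrite /op_mul; apply: le_trans (ler_norm_sum _ _ _) _.
rewrite exprS; apply: (@le_trans _ _ (\sum_r `|A s r| * op_size A ^+ k)).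
  by apply: ler_sum => r _; rewrite normrM ler_wpM2l.
by rewrite -mulr_suml ler_wpM2r // exprn_ge0 // sumr_ge0 // => *; exact: sumr_ge0.
Qed.

Lemma op_pow_opp A k s t :
  op_pow (fun s s' => - A s s') k s t = (-1) ^+ k * op_pow A k s t.
Proof.
elim: k s => [|k IH] s /=; first by rewrite mul1r.
rewrite /op_mul mulr_sumr; apply: eq_bigr => r _.
by rewrite -/(op_pow _ k) IH exprS; ring.
Qed.

(** [op_exp] is defined by [limn]; the geometric bound on the powers makes this an actual limit. The
    sign is moved into the matrix so that the coefficients are nonnegative. *)
Lemma op_exp_cvg (x : R) A s t : 0 <= x ->
  (fun N => \sum_(k < N) x ^+ k / k`!%:R * op_pow (fun s s' => - A s s') k s t) @ \oo -->
  op_exp (- x) A s t.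
Proof.
move=> x0; have -> : op_exp (- x) A s t =
    limn (fun N => \sum_(k < N) x ^+ k / k`!%:R * op_pow (fun s s' => - A s s') k s t).
  apply: (congr1 (fun u : nat -> R => limn u)); apply/funext => N; apply: eq_bigr => k _.
  by rewrite op_pow_opp (exprNn x); ring.
have bound k : `|op_pow (fun s s' => - A s s') k s t| <= 1 * op_size (fun s s' => - A s s') ^+ k.
  by rewrite mul1r op_pow_bound.
exact: (cvg_exp_series x0 bound).
Qed.

Lemma braket_diag (lam : R) A B (f : conf L -> R) :
  braket lam (op_mul A (op_mul (op_diag f) B)) =
  \sum_t (\sum_s seed lam s * A s t) * f t * (\sum_r B t r * seed lam r).
Proof.
rewrite braket_app.
transitivity (\sum_s \sum_t seed lam s * A s t * f t * (\sum_r B t r * seed lam r)).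
  apply: eq_bigr => s _; rewrite op_app_mul /op_app mulr_sumr; apply: eq_bigr => t _.
  by rewrite -/(op_app _ _ _) op_app_mul op_app_diag /op_app; ring.
by rewrite exchange_big; apply: eq_bigr => t _; rewrite -!mulr_suml.
Qed.

Lemma cvg_fsum (J : finType) (u : J -> nat -> R) (l : J -> R) :
  (forall j, u j @ \oo --> l j) -> (fun N => \sum_j u j N) @ \oo --> \sum_j l j.
Proof. by move=> ul; apply: cvg_big => [|j _]; [exact: add_continuous|exact: ul]. Qed.

Lemma braket_exp_cvg (lam x : R) A : 0 <= x ->
  (fun N => \sum_(n < N) x ^+ n / n`!%:R * braket lam (op_pow (fun s s' => - A s s') n))
  @ \oo --> braket lam (op_exp (- x) A).
Proof.
move=> x0; rewrite (_ : (fun N => _) = (fun N => \sum_s \sum_t seed lam s *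
  (\sum_(n < N) x ^+ n / n`!%:R * op_pow (fun s s' => - A s s') n s t) * seed lam t)); last first.
  apply/funext => N; rewrite (eq_bigr _ (fun n _ => mulr_sumr _ _ _ _)) exchange_big.
  apply: eq_bigr => s _ /=; rewrite (eq_bigr _ (fun n _ => mulr_sumr _ _ _ _)) exchange_big.
  apply: eq_bigr => t _ /=; rewrite mulr_sumr mulr_suml; apply: eq_bigr => n _.
  by ring.
apply: cvg_fsum => s; apply: cvg_fsum => t.
apply: cvgM; last exact: cvg_cst.
by apply: cvgM; [exact: cvg_cst|exact: op_exp_cvg].
Qed.

(** The binomial sum is the diagonal grouping of a product of two exponential series, the powers to
    the left and to the right of [f]. *)
Lemma braket_exp_diag_cvg (lam x : R) A (f : conf L -> R)
  (M := (fun s s' => - A s s') : op R L) (E := op_exp (- x) A) : 0 <= x ->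
  (fun N => \sum_(n < N) x ^+ n / n`!%:R * \sum_(k < n.+1) 'C(n, k)%:R *
     braket lam (op_mul (op_pow M (n - k)) (op_mul (op_diag f) (op_pow M k))))
  @ \oo --> braket lam (op_mul E (op_mul (op_diag f) E)).
Proof.
move=> x0; pose C : R := op_size M; pose S : R := \sum_(s : conf L) `|seed lam s|.
pose l j t := \sum_s seed lam s * op_pow M j s t.
pose r k t := \sum_s op_pow M k t s * seed lam s.
have C0 : 0 <= C by apply: sumr_ge0 => s _; exact: sumr_ge0.
have S0 : 0 <= S by exact: sumr_ge0.
have lS j t : `|l j t| <= S * C ^+ j.
  apply: le_trans (ler_norm_sum _ _ _) _; rewrite mulr_suml; apply: ler_sum => s _.
  by rewrite normrM ler_wpM2l // op_pow_bound.
have rS k t : `|r k t| <= S * C ^+ k.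
  apply: le_trans (ler_norm_sum _ _ _) _; rewrite mulr_suml; apply: ler_sum => s _.
  by rewrite normrM mulrC ler_wpM2l // op_pow_bound.
(* The constant collects the bounds on the left vector [l], on [f] and on the right vector [r]. *)
apply: (@cauchy_exp R x C (\sum_t S * `|f t| * S) _
  (fun j k => braket lam (op_mul (op_pow M j) (op_mul (op_diag f) (op_pow M k))))) => //.
  move=> j k; rewrite braket_diag; apply: le_trans (ler_norm_sum _ _ _) _.
  rewrite mulr_suml; apply: ler_sum => t _; rewrite !normrM.
  have -> : S * `|f t| * S * (C ^+ j * C ^+ k) = S * C ^+ j * `|f t| * (S * C ^+ k) by ring.
  by apply: ler_pM; [exact: mulr_ge0|exact: normr_ge0|apply: ler_wpM2r => //; exact: lS|exact: rS].
rewrite braket_diag (_ : (fun N => _) = (fun N => \sum_t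
  (\sum_s seed lam s * (\sum_(j < N) x ^+ j / j`!%:R * op_pow M j s t)) * f t *
  (\sum_s (\sum_(k < N) x ^+ k / k`!%:R * op_pow M k t s) * seed lam s))); last first.
  apply/funext => N; transitivity (\sum_t (\sum_(j < N) x ^+ j / j`!%:R * l j t) * f t *
      (\sum_(k < N) x ^+ k / k`!%:R * r k t)).
    transitivity (\sum_(j < N) \sum_(k < N) \sum_t
        x ^+ j / j`!%:R * l j t * f t * (x ^+ k / k`!%:R * r k t)).
      apply: eq_bigr => j _; apply: eq_bigr => k _; rewrite braket_diag mulr_sumr.
      by apply: eq_bigr => t _; rewrite -/(l j t) -/(r k t); ring.
    rewrite (eq_bigr _ (fun j _ => exchange_big _ _ _ _ _ _)) exchange_big /=.
    apply: eq_bigr => t _; rewrite -mulrA mulr_suml; apply: eq_bigr => j _.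
    by rewrite !mulr_sumr; apply: eq_bigr => k _; ring.
  apply: eq_bigr => t _; congr (_ * _ * _).
    rewrite /l (eq_bigr _ (fun j _ => mulr_sumr _ _ _ _)) exchange_big /=.
    by apply: eq_bigr => s _; rewrite mulr_sumr; apply: eq_bigr => j _; ring.
  rewrite /r (eq_bigr _ (fun j _ => mulr_sumr _ _ _ _)) exchange_big /=.
  by apply: eq_bigr => s _; rewrite mulr_suml; apply: eq_bigr => j _; ring.
apply: cvg_fsum => t; apply: cvgM; [apply: cvgM; last exact: cvg_cst|].
  by apply: cvg_fsum => s; apply: cvgM; [exact: cvg_cst|exact: op_exp_cvg].
by apply: cvg_fsum => s; apply: cvgM; [exact: op_exp_cvg|exact: cvg_cst].
Qed.

End OperatorExp.

(** * Numerator and denominator of the loop average *)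

Section Average.
Variables (R : realType) (L : nat) (lam beta : R) (f : conf L -> R).
Hypotheses (L_gt0 : (0 < L)%N) (evL : ~~ odd L) (beta_gt0 : 0 < beta).
Let H : op R L := H_XXZ_pm true lam.
Let c := expR (- ((L.*2.-1)%:R * beta)).
Local Open Scope classical_set_scope.

Lemma rho_int_lim (F : rconf R L -> R) (K : seq nat -> nat -> R) (l : R) :
  (forall w, F w = K (bond_list w) (slab0 w)) ->
  (fun N => \sum_(n < N) (beta / 2) ^+ n / n`!%:R * \sum_(k < n.+1) 'C(n, k)%:R *
    \sum_(bs : n.-tuple (bond L)) K [seq nat_of_ord b | b <- bs] k) @ \oo --> l ->
  rho_int beta F = c * l.
Proof.
move=> /funext -> Kl; apply: cvg_lim => //.
rewrite (_ : (fun N => _) = (fun N => c * \sum_(n < N) (beta / 2) ^+ n / n`!%:R *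
    \sum_(k < n.+1) 'C(n, k)%:R * \sum_(bs : n.-tuple (bond L)) K [seq nat_of_ord b | b <- bs] k)).
  by apply: cvgM => //; exact: cvg_cst.
apply/funext => N; rewrite mulr_sumr; apply: eq_bigr => n _.
by rewrite word_integral // -/c; ring.
Qed.

Lemma rho_int_numerator :
  rho_int beta (fun w => sqrtQ lam ^+ N_loops w * Econd true lam f w) =
  c * braket lam (op_mul (op_exp (- (beta / 2)) H) (op_mul (op_diag f) (op_exp (- (beta / 2)) H))).
Proof.
apply: (@rho_int_lim _ (fun es k => \sum_(tau : pspin L es)
  (consistent tau)%:R * W true lam tau * f (tau_at tau k))).
  move=> w; rewrite /Econd mulrA divff ?mul1r // expf_neq0 // gt_eqF //.
  by rewrite addr_gt0 // expR_gt0.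
have b2 : 0 <= beta / 2 by rewrite divr_ge0 ?ltW.
apply: eq_cvgn (@braket_exp_diag_cvg R L lam (beta / 2) H f b2) => N; apply: eq_bigr => n _; congr (_ * _).
by apply: eq_bigr => k _; rewrite word_sum // -ltnS.
Qed.

Lemma rho_int_denominator :
  rho_int beta (fun w : rconf R L => sqrtQ lam ^+ N_loops w) = c * braket lam (op_exp (- beta) H).
Proof.
apply: (@rho_int_lim _ (fun es k => sqrtQ lam ^+ nloops L es)) => //.
apply: eq_cvgn (@braket_exp_cvg R L lam beta H (ltW beta_gt0)) => N; apply: eq_bigr => n _.
have -> : braket lam (op_pow (fun s s' => - H s s') n) =
    \sum_(bs : n.-tuple (bond L)) sqrtQ lam ^+ nloops L [seq nat_of_ord b | b <- bs].
  (* With the constant function [1] inserted at slab [0], the word sum is the matrix element of a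
     plain power. *)
  have := @word_sum R L lam (fun=> 1) n 0 L_gt0 evL (leq0n n); rewrite subn0 /= => h.
  transitivity (braket lam (op_mul (op_pow (fun s s' => - H s s') n)
      (op_mul (op_diag (fun=> 1)) (op_id R (L := L))))).
    rewrite !braket_app; apply: eq_bigr => s _; rewrite op_app_mul; congr (_ * op_app _ _ _).
    by apply/funext => t; rewrite op_app_mul op_app_diag op_app_id mul1r.
  rewrite -h; apply: eq_bigr => bs _; rewrite -sum_W; last exact: bonds_lt.
  by apply: eq_bigr => tau _; rewrite mulr1.
rewrite -mulr_suml -natr_sum.
(* The summand does not depend on [k], so the binomials add up to [2 ^ n] and turn the powers of
   [beta / 2] into powers of [beta]. *)
have -> : (\sum_(k < n.+1) 'C(n, k))%N = (2 ^ n)%N.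
  by rewrite -[in RHS](addn1 1) expnDn; apply: eq_bigr => k _; rewrite !exp1n !muln1.
have n2 : (2 : R) ^+ n != 0 by rewrite expf_neq0.
rewrite natrX expr_div_n mulrA; congr (_ * _).
by rewrite mulrAC [LHS]mulrC [RHS]mulrC divfK.
Qed.

Lemma xxz_avg_loops : xxz_avg true lam lam beta f = mu_int lam beta (Econd true lam f).
Proof.
rewrite /xxz_avg /mu_int rho_int_numerator rho_int_denominator.
by rewrite -mulf_div divff ?mul1r // gt_eqF // expR_gt0.
Qed.

End Average.

Theorem theorem4p2 (R : realType) (L : nat) (lam beta : R) (f : conf L -> R) :
  0 <= lam -> (0 < L)%N -> ~~ odd L -> 0 < beta ->
  xxz_avg true lam lam beta f = mu_int lam beta (Econd true lam f) /\
  xxz_avg false lam (- lam) beta f = mu_int lam beta (Econd false lam f).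
Proof.
move=> _ L0 evL b0; split; first exact: xxz_avg_loops.
(* [coshR] is even and [sinhR] is odd, so changing the sign of the boundary field amounts to
   changing the sign of [lam]. *)
have HE : H_XXZ_pm false lam = H_XXZ_pm true (- lam) :> op R L.
  apply/funext => s; apply/funext => t.
  by rewrite /H_XXZ_pm /H_XXZ /coshR /sinhR /spin opprK [expR (- lam) + _]addrC; ring.
have EE : Econd false lam f = Econd true (- lam) f :> (rconf R L -> R).
  apply/funext => w; rewrite /Econd /sqrtQ opprK [expR (- lam) + _]addrC.
  congr (_ * _); apply: eq_bigr => tau _; congr (_ * _ * _).
  by rewrite /W /spin mulN1r mul1r.
have QE : sqrtQ (- lam) = sqrtQ lam by rewrite /sqrtQ opprK addrC.
by rewrite /xxz_avg HE EE /mu_int -QE; exact: xxz_avg_loops.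
Qed.
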